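(* Let $K$ be an Eberlein compact space, and let $L$ be an $NY$ compact space. If there exists a linear homeomorphic embedding $T:C_p(K)\to C_p(L)$, then $K$ is $NY$ compact as well.
   Context: All topological spaces are Tychonoff (completely regular Hausdorff). $C_p(X)$ is the space of real-valued continuous functions on $X$ with the topology of pointwise convergence. A linear homeomorphic embedding is a linear map that is a homeomorphism onto its image (the image is not assumed to be closed). A space is Eberlein compact if it is homeomorphic to a compact subset of a Banach space endowed with the weak topology. For a family $\{X_\gamma:\gamma\in\Gamma\}$ of nonempty spaces and points $a_\gamma\in X_\gamma$, the $\sigma$-product is $\sigma(X_\gamma,a_\gamma,\Gamma)=\{(x_\gamma)\in\prod_{\gamma\in\Gamma}X_\gamma: |\{\gamma\in\Gamma:x_\gamma\neq a_\gamma\}|<\omega\}$, with the subspace topology from the product. A compact space is $NY$ compact if it is homeomorphic to a subspace of $\sigma(X_\gamma,a_\gamma,\Gamma)$ for some set $\Gamma$, some compact metrizable spaces $X_\gamma$ and some points $a_\gamma\in X_\gamma$. *)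

(* Defs.v *)
From HB Require Import structures.
From mathcomp Require Import all_boot all_order all_algebra.
From mathcomp Require Import all_classical all_reals all_analysis.

Set Implicit Arguments.
Unset Strict Implicit.
Unset Printing Implicit Defensive.

Import Order.TTheory GRing.Theory Num.Theory.
Import numFieldNormedType.Exports.

Local Open Scope classical_set_scope.
Local Open Scope ring_scope.

(* [completely_regular_space] separates points from closed sets by a coarser
   uniformity; it does not include any separation of points. *)
Definition tychonoff_space (X : topologicalType) : Prop :=
  completely_regular_space X /\ hausdorff_space X.

Definition homeomorphism (X Y : topologicalType) (f : X -> Y) : Prop :=
  continuous f /\
  exists g : Y -> X, [/\ continuous g, cancel f g & cancel g f].

Definition homeomorphic (X Y : topologicalType) : Prop :=
  exists f : X -> Y, homeomorphism f.

(* For [A : set Y], the coercion of [A] to a type, [set_type A], carries the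
   subspace topology. *)
Definition corestrict (X Y : Type) (f : X -> Y) (x : X) : range f :=
  SigSub (mem_set (imageT f x)).

Definition embedding (X Y : topologicalType) (f : X -> Y) : Prop :=
  homeomorphism (corestrict f : X -> range f).

Definition metrizable (R : realType) (X : topologicalType) : Prop :=
  exists M : metricType R, homeomorphic X M.

(* The codomain is [R^o], i.e. [R] seen as a module over itself, so that
   [X -> R^o] is an [lmodType R]. *)
Definition Cp (R : realType) (X : topologicalType) : Type :=
  continuousType X R^o.

Section Cp_structure.
Context (R : realType) (X : topologicalType).

HB.instance Definition _ := Choice.on (Cp R X).

HB.instance Definition _ :=
  Topological.copy (Cp R X)
    (initial_topology (fun f : Cp R X => (f : X -> R^o) : {ptws X -> R^o})).

Definition cts_pred : {pred X -> R^o} := fun f => `[< continuous f >].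

Definition Cp_Sub (f : X -> R^o) (fP : f \in cts_pred) : Cp R X :=
  mkcts (asboolW fP).

Fact Cp_rect (P : Cp R X -> Type) :
  (forall f (fP : f \in cts_pred), P (Cp_Sub fP)) -> forall f, P f.
Proof.
move=> PSub f; have fP : (f : X -> R^o) \in cts_pred by apply/asboolP/cts_fun.
by have -> : f = Cp_Sub fP by exact/continuousEP.
Qed.

Fact Cp_SubK (f : X -> R^o) (fP : f \in cts_pred) : (Cp_Sub fP : X -> R^o) = f.
Proof. by []. Qed.

HB.instance Definition _ :=
  isSub.Build (X -> R^o) cts_pred (Cp R X) Cp_rect Cp_SubK.

Fact cts_pred_submod_closed : submod_closed cts_pred.
Proof.
split=> [|a f g /asboolP cf /asboolP cg]; apply/asboolP => x.
  exact: cst_continuous.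
by apply: continuousD; [apply: continuousZl_tmp; exact: cf | exact: cg].
Qed.

HB.instance Definition _ :=
  GRing.isSubmodClosed.Build R (X -> R^o) cts_pred cts_pred_submod_closed.

HB.instance Definition _ := [SubChoice_isSubLmodule of Cp R X by <:].

End Cp_structure.

Definition weak (R : realType) (E : normedModType R) : Type := E.

(* Indexed by the continuous dual of [E]. *)
Definition weak_topology_def (R : realType) (E : normedModType R) :=
  sup_topology (fun phi : {phi : {linear E -> R^o} | continuous phi} =>
    Topological.class (initial_topology (sval phi : E -> R^o))).

HB.instance Definition _ (R : realType) (E : normedModType R) :=
  Topological.copy (weak E) (weak_topology_def E).

Definition Eberlein_compact (R : realType) (K : topologicalType) : Prop :=
  exists (E : completeNormedModType R) (A : set (weak E)),
    compact A /\ homeomorphic K A.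

Definition sigma_product (I : Type) (X : I -> topologicalType)
    (a : forall i, X i) : set (prod_topology X) :=
  [set x | finite_set [set i | x i <> a i]].

Definition NY_compact (R : realType) (K : topologicalType) : Prop :=
  compact [set: K] /\
  exists (I : Type) (X : I -> topologicalType) (a : forall i, X i),
    (forall i, compact [set: X i] /\ metrizable R (X i)) /\
    exists A : set (sigma_product a), homeomorphic K A.

(* Main.v *)
Require Import Defs.
From HB Require Import structures.
From mathcomp Require Import all_boot all_order all_algebra.
From mathcomp Require Import all_classical all_reals all_analysis.
From mathcomp Require Import ring wochoice.

Set Implicit Arguments.
Unset Strict Implicit.
Unset Printing Implicit Defensive.

Import Order.TTheory GRing.Theory Num.Theory.
Import numFieldNormedType.Exports.

Local Open Scope classical_set_scope.
Local Open Scope ring_scope.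

(** Let [K] be Eberlein and [L] in a sigma-product indexed by [I].
    Every [y] in [L] has a finite support [supp y] in [K]: the support of the
    functional [f |-> T f y]. The support map is lower semicontinuous.
    For [S] a subset of [I], let [L_S] be the points of [L] whose nonzero
    coordinates lie in [S] and [X_S] the union of the supports of the points
    of [L_S].

    When [S] is closed under a suitable finitary closing-off operator, [X_S] is
    a closed retract of [K]. On one hand, the closing-off makes [T b] depend
    only on the coordinates in [S] for every [b] in the algebra generated by a
    set [B_S] of functions attached to [S]; since the restriction of a point of
    [L] to [S] is again in [L], and since [T] is an embedding, every point of
    [K] has the same [B_S]-coordinates as some point of [X_S]. On the other
    hand, [K] being Eberlein, [B_S] can be taken dense in a pointwise compact
    separating set of functions over a dense subset of [X_S], so that it
    separates the points of the closure of [X_S]. As the points of [L] have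
    finite supports in [I], the [X_S] also commute with directed unions.

    This yields retractions [r_S : K -> X_S] such that, along a well-ordered
    increasing chain of index sets, a given point [x] has only finitely many
    jumps [r_(S+1) x <> r_S x]: at a limit stage, [r_S x] already belongs to
    some earlier [X_S']. By induction on the cardinality of a generating set,
    the functions [f (r_(S+1) x) - f (r_S x)], for [f] in a family already
    obtained for [X_(S+1)], make [X_S] an NY compact space. *)

(** * Finitary set operators *)

Lemma countable_seqs (X : eqType) (A : set X) :
  countable A -> countable [set l : seq X | [set` l] `<=` A].
Proof.
move=> /countable_injP[f finj]; apply/countable_injP.
exists (pickle \o map f) => l l' /set_mem lA /set_mem l'A.
move=> /(pcan_inj pickleK).
elim: l l' lA l'A => [[]//|x l IH [//|x' l'] lA l'A /= [fxx' ll']].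
congr (_ :: _).
  apply: finj => //; rewrite inE; [apply: lA|apply: l'A];
    by rewrite /= mem_head.
apply: IH => // y ly; [apply: lA|apply: l'A]; by rewrite /= inE ly orbT.
Qed.

Lemma countableU (X : Type) (A B : set X) :
  countable A -> countable B -> countable (A `|` B).
Proof.
move=> cA cB.
have -> : A `|` B = \bigcup_(b in [set: bool]) (if b then A else B).
  apply/seteqP; split=> [x [Ax|Bx]|x [[] _ ?]]; first by exists true.
  - by exists false.
  - by left.
  - by right.
by apply: bigcup_countable => [|[] _].
Qed.

(** In order-theoretic terms: a Scott-continuous map between power sets that moreover preserves
    countability, so that closing off a countable set of indices keeps it countable. *)
Definition finitary (X Y : eqType) (F : set X -> set Y) :=
  [/\ {homo F : A B / A `<=` B},
      forall A y, F A y -> exists2 l : seq X, [set` l] `<=` A & F [set` l] y &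
      forall A, countable A -> countable (F A)].

Lemma finitary_seq (X Y : eqType) (F : set X -> set Y) (A : set X)
    (l : seq Y) : {homo F : A B / A `<=` B} ->
  (forall y, y \in l -> exists2 k : seq X, [set` k] `<=` A & F [set` k] y) ->
  exists2 k : seq X, [set` k] `<=` A & [set` l] `<=` F [set` k].
Proof.
move=> Fm; elim: l => [_|y l IH lF]; first by exists [::].
have [z zl|k kA lk] := IH; first by apply: lF; rewrite inE zl orbT.
have [k' k'A yk'] := lF y (mem_head _ _).
exists (k' ++ k) => [x|z] /=.
  by rewrite mem_cat => /orP[/k'A|/kA].
rewrite inE => /orP[/eqP->|zl].
  by apply: Fm yk' => x /= xk'; rewrite mem_cat xk'.
by apply: Fm (lk _ zl) => x /= xk; rewrite mem_cat xk orbT.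
Qed.

Lemma finitary_comp (X Y Z : eqType) (F : set X -> set Y) (G : set Y -> set Z) :
  finitary F -> finitary G -> finitary (G \o F).
Proof.
move=> [Fm Ff Fc] [Gm Gf Gc]; split=> [A B /Fm/Gm//|A z|A /Fc/Gc//].
move=> /= /Gf[l lF Gz]; have [|k kA lk] := @finitary_seq _ _ _ A l Fm.
  by move=> y yl; exact/Ff/lF.
by exists k => //; apply: Gm lk _ Gz.
Qed.

Lemma finitaryU (X Y : eqType) (F G : set X -> set Y) :
  finitary F -> finitary G -> finitary (fun A => F A `|` G A).
Proof.
move=> [Fm Ff Fc] [Gm Gf Gc]; split=> [A B AB|A y|A cA].
- by apply: setUSS; [exact: Fm|exact: Gm].
- by move=> [/Ff|/Gf] [l lA ly]; exists l => //; [left|right].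
- exact: countableU (Fc _ cA) (Gc _ cA).
Qed.

Lemma finitary_bigcup (X Y : eqType) (f : seq X -> set Y) :
  (forall l, countable (f l)) ->
  finitary (fun A => \bigcup_(l in [set l : seq X | [set` l] `<=` A]) f l).
Proof.
move=> fc; split=> [A B AB y [l lA ly]|A y [l lA ly]|A cA].
- by exists l => //; apply: subset_trans AB.
- by exists l => //; exists l.
- by apply: bigcup_countable => //; exact: countable_seqs.
Qed.

Definition hull (X : Type) (F : set X -> set X) (A : set X) : set X :=
  smallest [set S | F S `<=` S] A.

Section hull.
Context (X : eqType) (F : set X -> set X) (finF : finitary F).
Local Notation cl := (hull F).

Lemma sub_hull (A : set X) : A `<=` cl A.
Proof. exact: sub_gen_smallest. Qed.

Lemma hull_closed (A : set X) : F (cl A) `<=` cl A.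
Proof.
have [Fm _ _] := finF => x Fx S [FS AS]; apply: (FS).
by apply: Fm Fx => y; apply; split.
Qed.

Lemma hull_min (A S : set X) : F S `<=` S -> A `<=` S -> cl A `<=` S.
Proof. by move=> FS AS y; apply; split. Qed.

Lemma hull_mono : {homo cl : A B / A `<=` B}.
Proof.
move=> A B AB; apply: hull_min; first exact: hull_closed.
exact: subset_trans AB (@sub_hull B).
Qed.

(** The points generated by finite parts of [A] form an [F]-closed set containing [A]. A countable
    [A] is closed off after countably many iterations, because a finite part of the union of the
    increasing sets [G n] already lies in one of them. *)
Lemma finitary_hull : finitary cl.
Proof.
have [Fm Ff Fc] := finF.
split=> [|A x|A cA]; first exact: hull_mono.
  pose S := [set x | exists2 l : seq X, [set` l] `<=` A & cl [set` l] x].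
  have AS : A `<=` S.
    move=> y Ay; exists [:: y] => [z|]; first by rewrite /= inE => /eqP ->.
    by apply: sub_hull => /=; rewrite mem_head.
  suff : cl A `<=` S by apply.
  apply: hull_min AS => y /Ff[l lS Fy].
  have [k kA lk] := finitary_seq hull_mono lS.
  by exists k => //; apply: hull_closed; apply: Fm Fy.
pose G n := iter n (fun S => S `|` F S) A.
have Gc n : countable (G n).
  by elim: n => //= n IH; exact: countableU (Fc _ _).
have GS n : G n `<=` G n.+1 by move=> x; left.
have Gle m n : (m <= n)%N -> G m `<=` G n.
  elim: n => [|n IH]; first by rewrite leqn0 => /eqP ->.
  rewrite leq_eqVlt => /orP[/eqP->//|mn]; exact: subset_trans (IH mn) (GS n).
apply: (@sub_countable _ _ _ (\bigcup_n G n)); last exact: bigcup_countable.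
apply: subset_card_le; apply: hull_min; last by move=> x Ax; exists 0%N.
move=> x /Ff[l lG Fx].
suff [n ln] : exists n, [set` l] `<=` G n.
  by exists n.+1 => //; right; apply: Fm Fx.
elim: l lG {Fx} => [_|y l IH lG]; first by exists 0%N.
have [n ln] : exists n, [set` l] `<=` G n.
  by apply: IH => w lw; apply: lG; rewrite /= inE lw orbT.
have [|m _ ym] := lG y; first by rewrite /= mem_head.
exists (maxn m n) => w /=; rewrite inE => /orP[/eqP->|wl].
  exact: Gle (leq_maxl _ _) _ ym.
exact: Gle (leq_maxr _ _) _ (ln _ wl).
Qed.

End hull.

(** * Approximation on finitely many coordinates *)

(** At scale [k] the integer parts of the scaled coordinates form a code with countably many values;
    [E] contains one point of [Z] for each realised code, and two points with the same code are
    within [k.+1%:R^-1]. *)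
Lemma approx_countable (R : realType) (J : eqType) (Y : Type) (Z : set Y)
    (ev : J -> Y -> R) (l : seq J) :
  exists E : set Y, [/\ countable E, E `<=` Z &
    forall y (e : R), Z y -> 0 < e ->
    exists2 z, E z & forall j, j \in l -> `|ev j z - ev j y| < e].
Proof.
pose code (k : nat) y := [seq Num.floor (ev j y * k.+1%:R) | j <- l].
pose S (p : nat * seq int) := [set y | Z y /\ code p.1 y = p.2].
pose E p := if pselect (exists y, S p y) is left h then [set projT1 (cid h)]
            else set0.
exists (\bigcup_p E p); split.
  apply: bigcup_countable => // p _; rewrite /E; case: pselect => h.
    exact: countable1.
  exact: countable0.
  move=> y [p _]; rewrite /E; case: pselect => // h ->.
  by have [] := projT2 (cid h).
move=> y e Zy e0; have [k _ ke] : exists2 k : nat, True & k.+1%:R^-1 < e.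
  by have [k] := ltr_add_invr e0; rewrite add0r; exists k.
pose p := (k, code k y).
have [z Ez [_ Sz]] : exists2 z, E p z & S p z.
  rewrite /E; case: pselect => [h|[]]; last by exists y.
  by exists (projT1 (cid h)) => //; exact: projT2 (cid h).
exists z => [|j jl]; first by exists p.
apply: lt_trans ke.
have : Num.floor (ev j z * k.+1%:R) = Num.floor (ev j y * k.+1%:R).
  have /= := congr1 (fun s => nth 0 s (index j l)) Sz.
  by rewrite !(nth_map j) ?index_mem// nth_index.
move=> fl; have k0 : 0 < k.+1%:R :> R by rewrite ltr0n.
rewrite -(ltr_pM2r k0) mulVf ?gt_eqF// -[X in _ * X]gtr0_norm// -normrM mulrBl.
have /andP[z1 z2] := floor_itv (ev j z * k.+1%:R).
have /andP[y1 y2] := floor_itv (ev j y * k.+1%:R).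
rewrite fl in z1 z2; rewrite ltr_norml; apply/andP; split.
  rewrite ltrBrDr addrC ltrBlDr; apply: lt_le_trans y2 _.
  by rewrite intrD lerD2r.
rewrite ltrBlDr addrC; apply: lt_le_trans z2 _.
by rewrite intrD lerD2r.
Qed.

(** Finite intersection property: the sets of approximate solutions in [Z] form a filter base, and a
    cluster point solves all equations exactly. *)
Lemma compact_approx (R : realType) (X : topologicalType) (Z : set X)
    (J : eqType) (h : J -> X -> R) (t : J -> R) :
  compact Z -> (forall j, continuous (h j)) ->
  (forall (l : seq J) (e : R), 0 < e ->
     exists2 z, Z z & forall j, j \in l -> `|h j z - t j| < e) ->
  exists2 z, Z z & forall j, h j z = t j.
Proof.
move=> cZ ch H.
pose B (p : seq J * R) :=
  [set z | Z z /\ forall j, j \in p.1 -> `|h j z - t j| < p.2].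
pose F := filter_from [set p : seq J * R | 0 < p.2] B.
have FF : ProperFilter F.
  apply: filter_from_proper; last first.
    by move=> [l e] /= e0; have [z Zz lz] := H l e e0; exists z.
  apply: filter_from_filter; first by exists ([::], 1) => /=.
  move=> [l e] [l' e'] /= e0 e'0; exists (l ++ l', Num.min e e').
    by rewrite /= lt_min e0.
  move=> z [/= Zz lz]; split; split=> //= j jl.
    have := lz j; rewrite mem_cat jl => /(_ isT).
    by rewrite lt_min => /andP[].
  have := lz j; rewrite mem_cat jl orbT => /(_ isT).
  by rewrite lt_min => /andP[].
have FZ : F Z by exists ([::], 1) => [//=|z []].
have [z [Zz clz]] := cZ F FF FZ.
exists z => // j; apply/eqP; rewrite -subr_eq0 -normr_eq0.
apply/negPn/negP => d0.
have {}d0 : 0 < `|h j z - t j| / 2 by rewrite divr_gt0// lt0r d0 normr_ge0.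
have [y [[/= _ yj] yz]] : B ([:: j], `|h j z - t j| / 2) `&`
    [set y | `|h j z - h j y| < `|h j z - t j| / 2] !=set0.
  apply: clz; first by exists ([:: j], `|h j z - t j| / 2).
  by have /cvgrPdist_lt/(_ _ d0) := ch j z.
have := yj j; rewrite mem_head => /(_ isT) yj'.
have := ltrD yz yj'; rewrite -splitr ltNge; case/negP.
by apply: le_trans (ler_normD _ _); rewrite addrA subrK.
Qed.

(** * NY compact spaces through families of functions *)

Lemma near_seq (T : Type) (F : set_system T) (J : eqType) (P : J -> T -> Prop)
    (l : seq J) : Filter F -> (forall j, \forall x \near F, P j x) ->
  \forall x \near F, forall j, j \in l -> P j x.
Proof.
move=> FF H; elim: l => [|j l IH]; first by apply: nearW.
near=> x; move=> i; rewrite inE => /orP[/eqP ->|il].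
  by near: x; exact: H.
by move: i il; near: x.
Unshelve. all: by end_near. Qed.

(** Were [r] discontinuous at [x], points [r y] with [y] near [x] would stay in the compact set [Z]
    minus [V] while their coordinates approach those of [r x]. By [compact_approx] some point there
    would have exactly the coordinates of [r x], against separation. *)
Lemma lift_continuous (R : realType) (X K : topologicalType) (Z : set K)
    (J : eqType) (b : J -> K -> R) (b' : J -> X -> R) (r : X -> K) :
  compact Z -> (forall j, continuous (b j)) -> (forall j, continuous (b' j)) ->
  (forall x, Z (r x)) -> (forall j x, b j (r x) = b' j x) ->
  (forall z z', Z z -> Z z' -> (forall j, b j z = b j z') -> z = z') ->
  continuous r.
Proof.
move=> cZ cb cb' Zr br sep x U; rewrite nbhsE => -[V [oV Vrx] VU].
have cZV : compact (Z `&` ~` V) by apply: compact_closedI => //; exact: open_closedC.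
change (nbhs x (r @^-1` U)); apply: contrapT => nU.
have [z [Zz nVz] zx] : exists2 z, (Z `&` ~` V) z & forall j, b j z = b' j x.
  apply: compact_approx => // l e e0; apply: contrapT => /forall2NP nz.
  apply: nU; near=> y; apply: VU => /=; apply: contrapT => nVy.
  have [|[]//] := nz (r y); first by case; split=> //; exact: Zr.
  move=> j jl; rewrite br distrC; move: j jl; near: y.
  apply: near_seq => j.
  by have /cvgrPdist_lt/(_ _ e0) := cb' j x.
by apply: nVz; rewrite (sep z (r x))// => j; rewrite zx br.
Unshelve. all: by end_near. Qed.

(* The maps [x |-> (g i n x)_n] embed a compact [K] in a sigma-product of compact
   metrizable spaces with base points [0]. *)
Definition NY_family (R : realType) (K : topologicalType) (I : Type)
    (g : I -> nat -> K -> R) :=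
  [/\ forall i n, continuous (g i n),
      forall x, finite_set [set i | exists n, g i n x <> 0] &
      forall x y, (forall i n, g i n x = g i n y) -> x = y].

Lemma prod_coord_continuous (I : Type) (X : I -> topologicalType) (i : I) :
  continuous (fun f : prod_topology X => f i).
Proof.
move=> f; have /cvg_sup/(_ i) ff : f --> f by apply: cvg_id.
apply: cvg_trans (@initial_continuous _ _ (fun f : (forall j, X j) => f i) f).
exact: cvg_app ff.
Qed.

Lemma prod_cvg (I : Type) (X : I -> topologicalType) (T : topologicalType)
    (f : T -> prod_topology X) :
  (forall i, continuous (fun t => f t i)) -> continuous f.
Proof.
move=> cf t; apply/cvg_sup => i A.
rewrite nbhsE => -[_ [[B oB <-] Bt] BA].
have /= fB : nbhs t [set s | B (f s i)].
  by apply: cf; apply: open_nbhs_nbhs; split.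
by rewrite /= /nbhs /=; apply: filterS fB => s Bs; apply: BA.
Qed.

Lemma initial_cvg (S : choiceType) (X T : topologicalType) (v : S -> X)
    (f : T -> initial_topology v) :
  continuous (fun t => v (f t)) -> continuous f.
Proof.
move=> cf t A; rewrite nbhsE => -[_ [[B oB <-] Bt] BA].
have /= fB : nbhs t [set s | B (v (f s))].
  by apply: cf; apply: open_nbhs_nbhs; split.
by rewrite /= /nbhs /=; apply: filterS fB => s Bs; apply: BA.
Qed.

Lemma mdist_continuous (R : realType) (M : metricType R) (m : M) :
  continuous (fun y => mdist m y).
Proof.
move=> y; apply/cvgrPdist_lt => e e0.
have : nbhs y (ball y e) by apply: nbhsx_ballx.
apply: filterS => z; rewrite ballEmdist /= => yz.
rewrite ltr_norml ltrBrDr addrC ltrBlDr ltrBlDr; apply/andP; split.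
  apply: le_lt_trans (metric_triangle _ y _) _.
  by rewrite ltrD2l.
apply: le_lt_trans (metric_triangle _ z _) _.
by rewrite addrC ltrD2r metric_sym.
Qed.

Lemma compact_net (R : realType) (M : metricType R) (e : R) :
  compact [set: M] -> 0 < e -> exists l : seq M, forall y,
    exists2 m, m \in l & mdist m y < e.
Proof.
move=> cM e0; apply: contrapT => /forallNP nl.
(* The function is twice the positive part of [e - mdist m y], so it vanishes exactly when [y] is at
   distance at least [e] from [m]. A common zero would be at distance at least [e] from itself. *)
have [|l d d0|y _ hy] := @compact_approx R M setT M
    (fun m y => `|e - mdist m y| + (e - mdist m y)) (fun=> 0) cM.
- move=> m y; have cm : (fun y => e - mdist m y) @ y --> e - mdist m y.
    by apply: cvgB; [exact: cvg_cst|exact: mdist_continuous].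
  by apply: cvgD => //; exact: cvg_norm.
- have /existsNP[y ny] := nl l; exists y => // m ml.
  have ed : e - mdist m y <= 0.
    by rewrite subr_le0 leNgt; apply/negP => my; apply: ny; exists m.
  by rewrite subr0 (ler0_norm ed) addNr normr0.
- have := hy y; rewrite mdistxx subr0 gtr0_norm// => /eqP.
  by rewrite paddr_eq0 ?ltW// (gt_eqF e0).
Qed.

(** On each metrizable factor, take the distances to the points of a dense sequence, shifted so as
    to vanish at the base point. *)
Lemma NY_compact_family (R : realType) (L : topologicalType) :
  NY_compact R L ->
  exists (I : Type) (g : I -> nat -> L -> R), NY_family g.
Proof.
move=> [cL [I [X [a [cmX [A [psi [cpsi [psi' [_ psiK _]]]]]]]]]].
pose metX i := cid (cmX i).2.
pose M i : metricType R := projT1 (metX i).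
have homX i : exists f : X i -> M i, homeomorphism f := projT2 (metX i).
pose phi i : X i -> M i := projT1 (cid (homX i)).
have hphi i : homeomorphism (phi i) := projT2 (cid (homX i)).
have cM i : compact [set: M i].
  have [cphi [phi' [_ _ phiK]]] := hphi i.
  have -> : [set: M i] = phi i @` [set: X i].
    by apply/seteqP; split=> // y _; exists (phi' y).
  apply: continuous_compact; last by have [] := cmX i.
  exact: continuous_subspaceT.
pose p i (y : L) : M i := phi i ((set_val (set_val (psi y))) i).
have cp i : continuous (p i).
  move=> y; apply: continuous_comp; last by have [cphi _] := hphi i; exact: cphi.
  apply: (@continuous_comp _ _ _ psi (fun t => set_val (set_val t) i)).
    exact: cpsi.
  apply: (@continuous_comp _ _ _ set_val (fun t : sigma_product a => set_val t i)).
    exact: initial_continuous.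
  apply: (@continuous_comp _ _ _ set_val (fun t : prod_topology X => t i)).
    exact: initial_continuous.
  exact: prod_coord_continuous.
have net_ex i (k : nat) : exists l : seq (M i), forall y,
    exists2 m, m \in l & mdist m y < k.+1%:R^-1 by exact: compact_net.
pose net i k := projT1 (cid (net_ex i k)).
have hnet i k := projT2 (cid (net_ex i k)).
(* The sequence runs through all finite nets, [n] coding the pair of a scale and a position; codes
   out of range fall back on harmless values. *)
pose s i (n : nat) : M i := let kj := odflt (0, 0)%N (unpickle n) in
  nth (phi i (a i)) (net i kj.1) kj.2.
exists I, (fun i n y => mdist (s i n) (p i y) - mdist (s i n) (phi i (a i))).
split=> [i n y|y|x y xy].
- apply: cvgB; last exact: cvg_cst.
  by apply: continuous_comp; [exact: cp|exact: mdist_continuous].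
- apply: sub_finite_set (set_valP (set_val (psi y))) => i [n ny] ya.
  apply: ny; have -> : p i y = phi i (a i) by congr (phi i _); exact: ya.
  by rewrite subrr.
- suff pxy i : p i x = p i y.
    rewrite -(psiK x) -(psiK y); congr psi'.
    apply: val_inj; apply: val_inj; apply: functional_extensionality_dep => i.
    have [_ [phi' [_ phiK _]]] := hphi i.
    by rewrite -[LHS]phiK -[RHS]phiK; congr phi'; exact: pxy.
  have sxy n : mdist (s i n) (p i x) = mdist (s i n) (p i y).
    by have /addIr := xy i n.
  apply: mdist_positivity; apply/eqP; rewrite eq_le mdist_ge0 andbT.
  apply/ler_addgt0Pl => e e0; rewrite addr0.
  have [k] := ltr_add_invr (divr_gt0 e0 (ltr0Sn R 1)); rewrite add0r => ke.
  have [m ml mx] := hnet i k (p i x).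
  have sm : s i (pickle (k, index m (net i k))) = m.
    by rewrite /s pickleK /= nth_index.
  apply: le_trans (metric_triangle _ m _) _.
  have := sxy (pickle (k, index m (net i k))).
  rewrite sm => <-; rewrite metric_sym [X in _ <= X]splitr.
  by apply: lerD; apply: ltW; exact: lt_trans ke.
Qed.

(* A set of sequences with the distance [sup_n min(1/(n+1), |s n - t n|)], which
   induces the pointwise topology. *)
Definition seqspace (R : realType) (C : set (nat -> R)) : Type := set_type C.

Section seqspace.
Context (R : realType) (C : set (nat -> R)).
Implicit Types s t : seqspace C.

HB.instance Definition _ := Choice.on (seqspace C).

Definition seqval (s : seqspace C) : nat -> R := set_val s.

Let d s t n := Num.min (n.+1%:R^-1) `|seqval s n - seqval t n|.

Definition seqdist s t := sup (range (d s t)).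

Lemma seqdist_ub s t n : d s t n <= seqdist s t.
Proof.
apply: ub_le_sup; last by exists n.
exists 1 => _ [m _ <-]; rewrite ge_min; apply/orP; left.
by rewrite invf_le1 ?ltr0n// ler1n.
Qed.

Lemma seqdist_le s t e : (forall n, d s t n <= e) -> seqdist s t <= e.
Proof.
move=> h; apply: ge_sup; first by exists (d s t 0%N); exists 0%N.
by move=> _ [n _ <-].
Qed.

Lemma seqdist0 s : seqdist s s = 0.
Proof.
apply/eqP; rewrite eq_le; apply/andP; split.
  by apply: seqdist_le => n; rewrite /d subrr normr0 ge_min lexx orbT.
apply: le_trans (seqdist_ub s s 0); rewrite /d subrr normr0.
by rewrite le_min invr_ge0 ler0n lexx.
Qed.

Lemma seqdist_eq0 s t : seqdist s t = 0 -> s = t.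
Proof.
move=> st; apply: val_inj; apply/funext => n.
apply/eqP; rewrite -subr_eq0 -normr_le0.
have := seqdist_ub s t n; rewrite st /d ge_min.
by rewrite invr_le0 lern0.
Qed.

Lemma seqdistC s t : seqdist s t = seqdist t s.
Proof.
rewrite /seqdist (_ : d s t = d t s)//.
by apply/funext => n; rewrite /d distrC.
Qed.

Lemma seqdist_triangle t s u : seqdist s u <= seqdist s t + seqdist t u.
Proof.
apply: seqdist_le => n.
apply: le_trans (lerD (seqdist_ub s t n) (seqdist_ub t u n)); rewrite /d.
set c := n.+1%:R^-1; have c0 : 0 <= c by rewrite invr_ge0 ler0n.
have [h|h] := leP c `|seqval s n - seqval t n|.
  by rewrite ge_min lerDl le_min c0 normr_ge0.
have [h'|h'] := leP c `|seqval t n - seqval u n|.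
  by rewrite ge_min lerDr normr_ge0.
by rewrite ge_min; apply/orP; right; exact: ler_distD.
Qed.

HB.instance Definition _ := @isMetric.Build R (seqspace C)
  seqdist seqdist0 seqdist_eq0 seqdistC seqdist_triangle.

Lemma seqval_continuous n : continuous (fun s => seqval s n).
Proof.
move=> s; have FF := nbhs_filter s; apply/cvgrPdist_lt => e e0.
have m0 : 0 < Num.min e n.+1%:R^-1 by rewrite lt_min e0 invr_gt0 ltr0n.
have : nbhs s (ball s (Num.min e n.+1%:R^-1)) by exact: nbhsx_ballx.
apply: filterS => t; rewrite ballEmdist /= => st.
have := le_lt_trans (seqdist_ub s t n) st.
rewrite /d lt_min => /andP[+ +]; rewrite !gt_min ltxx /=.
by case/orP => // ce uc; exact: lt_trans uc ce.
Qed.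

Lemma seqspace_cvg (T : topologicalType) (f : T -> seqspace C) :
  (forall n, continuous (fun t : T => seqval (f t) n)) -> continuous f.
Proof.
move=> cf t A /nbhs_ballP[e /= e0 eA].
have [N] := ltr_add_invr (divr_gt0 e0 (ltr0Sn R 1)); rewrite add0r => Ne.
change (nbhs t (f @^-1` A)); near=> u; apply: eA; rewrite ballEmdist /=.
apply: (@le_lt_trans _ _ (e / 2)); last by rewrite ltr_pdivrMr// ltr_pMr// ltr1n.
apply: seqdist_le => n; rewrite /d ge_min.
(* Past [N] the cap [n.+1%:R^-1] is below [e / 2]; continuity is used only for the finitely many
   earlier coordinates. *)
have [nN|Nn] := leqP n N; last first.
  apply/orP; left; apply: le_trans (ltW Ne).
  by rewrite lef_pV2 ?posrE ?ltr0n// ler_nat ltnW.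
apply/orP; right; apply: ltW.
have {nN} : n \in iota 0 N.+1 by rewrite mem_iota.
move: n; near: u; apply: near_seq => n.
by have /cvgrPdist_lt/(_ _ (divr_gt0 e0 (ltr0Sn R 1))) := cf n t.
Unshelve. all: by end_near. Qed.

End seqspace.

Lemma NY_family_compact (R : realType) (K : topologicalType) (I : Type)
    (g : I -> nat -> K -> R) :
  compact [set: K] -> NY_family g -> NY_compact R K.
Proof.
move=> cK [cg fing sepg]; split=> //.
(* The zero sequence is added to serve as base point: it need not be a value of [g i]. *)
pose C i : set (nat -> R) := range (fun x n => g i n x) `|` [set fun=> 0].
have Cg i x : C i (fun n => g i n x) by left; exists x.
have C0 i : C i (fun=> 0) by right.
pose q i x : seqspace (C i) := SigSub (mem_set (Cg i x)).
pose a i : seqspace (C i) := SigSub (mem_set (C0 i)).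
have cq i : continuous (q i) by apply: seqspace_cvg => n; exact: cg.
exists I, (fun i => seqspace (C i)), a; split.
  move=> i; split; last first.
    exists (seqspace (C i)), id; split; first by move=> x; exact: cvg_id.
    by exists id; split=> // x; exact: cvg_id.
  have -> : [set: seqspace (C i)] = q i @` setT `|` [set a i].
    apply/seteqP; split=> // s _.
    have [[x _ xs]|s0] := set_valP s; [left|right].
      by exists x => //; apply: val_inj.
    by apply: val_inj; exact: s0.
  apply: compactU; last exact: compact_set1.
  by apply: continuous_compact cK; apply: continuous_subspaceT; exact: cq.
have Psiq x : sigma_product a (fun i => q i x).
  apply: sub_finite_set (fing x) => i qa; apply: contrapT => /forallNP n0.
  apply: qa; apply: val_inj; apply/funext => n /=.
  exact: contrapT (n0 n).
pose Psi x : sigma_product a := SigSub (mem_set (Psiq x)).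
have cPsi : continuous Psi.
  by apply: initial_cvg; apply: prod_cvg => i; exact: cq.
pose F x : range Psi := corestrict Psi x.
have cF : continuous F by apply: initial_cvg; exact: cPsi.
have hG (y : range Psi) : exists x, F x = y.
  by have [x _ xy] := set_valP y; exists x; apply: val_inj.
pose G y := projT1 (cid (hG y)).
have FG y : F (G y) = y := projT2 (cid (hG y)).
pose coord (j : {classic I * nat}) (y : range Psi) : R :=
  seqval ((set_val (set_val y)) j.1) j.2.
have sepF x y : (forall j, coord j (F x) = coord j (F y)) -> x = y.
  by move=> xy; apply: sepg => i n; exact: (xy (i, n)).
have GF : cancel F G by move=> x; apply: sepF => j; rewrite FG.
exists (range Psi), F; split=> //; exists G; split=> //.
(* The inverse is continuous because its composites with the separating functions [g] are
   coordinates of the product. *)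
apply: (@lift_continuous R _ _ setT {classic I * nat}
  (fun j x => g j.1 j.2 x) coord) => //.
- move=> j y; rewrite /coord.
  pose c1 (y : range Psi) : seqspace (C j.1) := set_val (set_val y) j.1.
  refine (@continuous_comp _ (seqspace (C j.1)) _ c1
    (fun s => seqval s j.2) y _ _); last exact: seqval_continuous.
  apply: (@continuous_comp _ _ _ set_val (fun t : sigma_product a => set_val t j.1)).
    exact: initial_continuous.
  apply: (@continuous_comp _ _ _ set_val
    (fun t : prod_topology (fun i => seqspace (C i)) => t j.1)).
    exact: initial_continuous.
  exact: prod_coord_continuous.
- by move=> j y; rewrite -[in RHS](FG y).
- by move=> x y _ _ xy; apply: sepg => i n; exact: (xy (i, n)).
Qed.

(** This shape covers both the linearity conditions defining the dual ball and, with [a = 1] and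
    [w = 0], the equality of two functions. *)
Lemma closed_eq0_lin (R : realType) (X : topologicalType) (u v w : X -> R)
    (a : R) : continuous u -> continuous v -> continuous w ->
  closed [set x | u x - a * v x - w x = 0].
Proof.
move=> cu cv cw.
apply: (@preimage_closed _ _ (fun x => u x - a * v x - w x) [set x | x = 0]).
  move=> x _; apply: cvgB; last exact: cw.
  by apply: cvgB; [exact: cu|apply: cvgMr; exact: cv].
exact: closed_eq.
Qed.

(** * Eberlein compacta paired with the dual ball *)

Section dual_ball.
Context (R : realType) (E : completeNormedModType R).

Definition dual_ball : set (prod_topology (fun _ : E => R^o)) :=
  [set f | linear (f : E -> R^o) /\ forall x, `|f x| <= `|x|].

(** Banach-Alaoglu: linearity is an intersection of closed conditions on a product of segments,
    which is compact by Tychonoff's theorem. *)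
Lemma dual_ball_compact : compact dual_ball.
Proof.
pose A (x : E) : set R^o := [set r : R | `|r| <= `|x|].
have cA x : compact (A x).
  have -> : A x = [set` `[- `|x|, `|x|]].
    by apply/seteqP; split=> r; rewrite /A /= in_itv /= ler_norml.
  exact: segment_compact.
have cT := @tychonoff E (fun=> R^o) A cA.
pose P (axy : R * E * E) : set (prod_topology (fun _ : E => R^o)) :=
  [set f | f (axy.1.1 *: axy.1.2 + axy.2) - axy.1.1 * f axy.1.2 - f axy.2 = 0].
have -> : dual_ball = [set f | forall x, A x (f x)] `&`
    \bigcap_(axy in [set: R * E * E]) P axy.
  apply/seteqP; split=> [f [lf bf]|f [bf lf]]; split=> //.
    by move=> [[a x] y] _; rewrite /P /= lf addrAC addrK subrr.
  move=> a x y; have := lf (a, x, y) Logic.I; rewrite /P /=.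
  by move/subr0_eq/eqP; rewrite subr_eq addrC => /eqP.
apply: compact_closedI => //; apply: closed_bigI => axy _.
apply: (@closed_eq0_lin R (prod_topology (fun _ : E => R^o))
  (fun f => f (axy.1.1 *: axy.1.2 + axy.2)) (fun f => f axy.1.2)
  (fun f => f axy.2) axy.1.1); exact: prod_coord_continuous.
Qed.

End dual_ball.

(** [H] is the dual unit ball with the pointwise topology. If all its elements agree at [k] and
    [k'], the images of these points are indistinguishable in the weak topology, so [k = k'] as [K]
    is Hausdorff. *)
Lemma Eberlein_pairing (R : realType) (K : topologicalType) :
  Eberlein_compact R K -> hausdorff_space K ->
  exists (Y : topologicalType) (H : set Y) (e : Y -> K -> R),
    [/\ compact H, forall h, H h -> continuous (e h),
        forall k, continuous (e^~ k) &
        forall k k', (forall h, H h -> e h k = e h k') -> k = k'].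
Proof.
move=> [E [A [cA [psi [cpsi [psi' [cpsi' psiK _]]]]]]] hK.
exists (prod_topology (fun _ : E => R^o)), (@dual_ball R E),
  (fun f k => f (set_val (psi k))).
have weak_cts (phi : {linear E -> R^o}) : continuous phi ->
    continuous (fun x : weak E => phi x).
  move=> cphi x.
  have /cvg_sup/(_ (exist _ phi cphi)) xx : x --> (x : weak E) by apply: cvg_id.
  apply: cvg_trans (@initial_continuous _ _ (phi : E -> R^o) x).
  exact: cvg_app xx.
split.
- exact: dual_ball_compact.
- move=> h [lh bh].
  pose hl := GRing.isLinear.Build R E R^o _ h lh.
  pose phi : {linear E -> R^o} := HB.pack (h : E -> R^o) hl.
  have cphi : continuous phi.
    apply: bounded_linear_continuous; apply/bounded_funP => r; exists r => x xr.
    exact: le_trans (bh x) xr.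
  move=> k; apply: (@continuous_comp _ _ _ psi (fun t : A => phi (set_val t))).
    exact: cpsi.
  apply: (@continuous_comp _ _ _ set_val (phi : weak E -> R^o)).
    exact: initial_continuous.
  exact: weak_cts.
- by move=> k; exact: prod_coord_continuous.
- move=> k k' kk'.
  have dual_eq (phi : {linear E -> R^o}) : continuous phi ->
      phi (set_val (psi k)) = phi (set_val (psi k')).
    move=> cphi.
    (* Dividing [phi] by a bound [r] of its norm brings it into the dual ball. *)
    have /linear_bounded_continuous/linear_boundedP/pinfty_ex_gt0[r r0 br] := cphi.
    apply: (@mulfI _ r^-1); first by rewrite gt_eqF// invr_gt0.
    apply: (kk' (fun x => r^-1 * phi x)); split=> [a x y|x].
      by rewrite linearP mulrDr; congr (_ + _); rewrite mulrCA.
    by rewrite normrM gtr0_norm ?invr_gt0// ler_pdivrMl.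
  apply: hK => U V Uk Vk'; exists k'; split; last exact: nbhs_singleton.
  have : nbhs (psi k) (psi' @^-1` U) by apply: cpsi'; rewrite psiK.
  rewrite nbhsE => -[_ [[B oB <-] Bk] BU].
  suff : (psi' @^-1` U) (psi k') by rewrite /= psiK.
  apply: BU => /=.
  have : (set_val (psi k') : weak E) @[_ --> k] --> (set_val (psi k) : weak E).
    apply/cvg_sup => -[phi cphi] W; rewrite nbhsE => -[_ [[D oD <-] Dk] DW].
    apply: nearW => ?; apply: DW => /=; rewrite -dual_eq//.
  move=> /(_ B) h; have : \forall _ \near k, B (set_val (psi k')).
    by apply: h; apply: open_nbhs_nbhs; split.
  by move=> /nbhs_singleton.
Qed.

(** * The retractions associated with an operator *)

(* [X A] stands for the closed retract generated by the set of indices [A], and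
   [r A] for the retraction onto it. *)
Record skeleton (K : topologicalType) (I : eqType)
    (X : set I -> set K) (r : set I -> K -> K) : Prop := Skeleton {
  skel_continuous : forall A, continuous (r A);
  skel_in : forall A x, X A (r A x);
  skel_id : forall A x, X A x -> r A x = x;
  skel_mono : forall A B, A `<=` B -> X A `<=` X B;
  skel_comp : forall A B x, A `<=` B -> r A (r B x) = r A x;
  skel_finitary : forall A x, X A x ->
    exists2 l : seq I, [set` l] `<=` A & X [set` l] x;
  skel_full : X setT = setT }.

(** * Finite supports of the functionals [f |-> T f y] *)

Section operator.
Context (R : realType) (K L : topologicalType).
Context (cK : compact [set: K]) (cL : compact [set: L]).
Context (crK : completely_regular_space K).
Context (T : (K -> R) -> L -> R).
Context (T_linear : forall (a : R) (f f' : K -> R) y, continuous f ->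
  continuous f' -> T (fun x => a * f x + f' x) y = a * T f y + T f' y).
Context (T_continuous : forall f : K -> R, continuous f -> continuous (T f)).
Context (T_local : forall y, exists P : seq K, forall f : K -> R,
  continuous f -> (forall x, x \in P -> f x = 0) -> T f y = 0).
Context (T_inj : forall x, exists Q : seq L, forall f : K -> R,
  continuous f -> (forall y, y \in Q -> T f y = 0) -> f x = 0).
Context (I : eqType) (g : I -> nat -> L -> R) (NYg : NY_family g).
Context (Y : topologicalType) (H : set Y) (e : Y -> K -> R).
Context (cH : compact H) (ce : forall h, H h -> continuous (e h))
  (ceK : forall k, continuous (e^~ k))
  (sepH : forall k k', (forall h, H h -> e h k = e h k') -> k = k').

(** Take a determining sequence of least length: deleting [x] from it destroys determinacy, and a
    function witnessing this is the required [f]. *)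
Lemma supp_ex y : exists P : seq K,
  (forall f : K -> R, continuous f -> (forall x, x \in P -> f x = 0) -> T f y = 0) /\
  forall x, x \in P -> exists f : K -> R,
    [/\ continuous f, forall z, z \in P -> z != x -> f z = 0 & T f y <> 0].
Proof.
pose det (P : seq K) := forall f : K -> R, continuous f ->
  (forall x, x \in P -> f x = 0) -> T f y = 0.
have exn : exists n, `[< exists P, det P /\ size P = n >].
  by have [P dP] := T_local y; exists (size P); apply/asboolP; exists P.
have [_ /asboolP[P [dP <-]] minP] := ex_minnP exn.
exists P; split=> // x xP; apply: contrapT => nf.
have : det [seq z <- P | z != x].
  move=> f cf f0; apply: contrapT => Tf; apply: nf; exists f; split=> // z zP zx.
  by apply: f0; rewrite mem_filter zx.
move=> dP'; have : (size P <= size [seq z <- P | z != x])%N.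
  by apply: minP; apply/asboolP; exists [seq z <- P | z != x].
rewrite leqNgt size_filter -[X in (_ < X)%N](count_predC (predC1 x)).
rewrite -addn1 leq_add2l -has_count; case/negP; apply/hasP.
by exists x => //=; rewrite eqxx.
Qed.

Definition supp y : seq K := projT1 (cid (supp_ex y)).

Lemma supp_det y f : continuous f -> (forall x, x \in supp y -> f x = 0) ->
  T f y = 0.
Proof. by have [h _] := projT2 (cid (supp_ex y)); exact: h. Qed.

Lemma bump (x : K) (U : set K) : open U -> U x ->
  exists u : K -> R, [/\ continuous u, u x = 1 & forall z, ~ U z -> u z = 0].
Proof.
move=> oU Ux.
have /(@uniform_separatorP _ R)[f [cf _ f0 f1]] :=
  crK (open_closedC oU) (fun h => h Ux).
exists (fun z => 1 - f z); split.
- by move=> z; apply: cvgB; [exact: cvg_cst|exact: cf].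
- by rewrite (f0 (f x)) ?subr0//; exists x.
- by move=> z nUz; rewrite (f1 (f z)) ?subrr//; exists z.
Qed.

(** Multiply the function detecting [x] by a bump at [x]. No value on [supp y] changes, since the
    bump is 1 at [x] and the function vanishes at the other points. As [T u] is continuous, this is
    the lower semicontinuity of [supp]. *)
Lemma supp_lsc y x (U : set K) : x \in supp y -> open U -> U x ->
  exists u : K -> R, [/\ continuous u, forall z, ~ U z -> u z = 0 & T u y <> 0].
Proof.
move=> xy oU Ux; have [_ /(_ x xy)[f [cf f0 Tf]]] := projT2 (cid (supp_ex y)).
have [u [cu ux u0]] := bump oU Ux.
have cfu : continuous (fun z => f z * u z).
  by move=> z; apply: cvgM; [exact: cf|exact: cu].
exists (fun z => f z * u z); split=> //.
  by move=> z /u0 ->; rewrite mulr0.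
suff -> : T (fun z => f z * u z) y = T f y by [].
have cd : continuous (fun z => -1 * f z + f z * u z).
  by move=> z; apply: cvgD => //; [apply: cvgMr; exact: cf|exact: cfu].
have : T (fun z => -1 * f z + f z * u z) y = 0.
  apply: supp_det => // z zy; have [->|zx] := eqVneq z x.
    by rewrite ux mulr1 mulN1r addNr.
  by rewrite (f0 z zy zx) mulr0 mul0r addr0.
rewrite T_linear// mulN1r => /eqP; rewrite addrC subr_eq0 => /eqP ->//.
Qed.

(** For each [k] finitely many coordinates control [f] up to [k.+1%:R^-1]: otherwise compactness of
    the set of pairs with a larger gap would yield such a pair agreeing on all coordinates, hence
    equal. The union over [k] is countable. *)
Lemma countable_dependence (f : L -> R) : continuous f ->
  exists2 c : set I, countable c &
    forall y y', (forall i n, c i -> g i n y = g i n y') -> f y = f y'.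
Proof.
move=> cf; have [cg _ sepg] := NYg.
have net (k : nat) : exists l : seq (I * nat), forall y y',
    (forall j, j \in l -> g j.1 j.2 y = g j.1 j.2 y') -> `|f y - f y'| < k.+1%:R^-1.
  apply: contrapT => /forallNP nl.
  pose Z := [set p : L * L | k.+1%:R^-1 <= `|f p.1 - f p.2|].
  have [||l d d0|[y y'] /= Zy yy'] := @compact_approx R (L * L)%type Z
      (I * nat)%type (fun j p => g j.1 j.2 p.1 - g j.1 j.2 p.2) (fun=> 0).
  - rewrite -[Z]setTI; apply: compact_closedI.
      by rewrite -setXTT; exact: compact_setX.
    apply: (@preimage_closed _ _ (fun p : L * L => `|f p.1 - f p.2|)
      [set x | k.+1%:R^-1 <= x]); last exact: closed_ge.
    move=> p _; apply: cvg_norm; apply: cvgB; apply: continuous_comp; try exact: cf.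
      exact: cvg_fst.
    exact: cvg_snd.
  - move=> j p; apply: cvgB; apply: continuous_comp; try exact: cg.
      exact: cvg_fst.
    exact: cvg_snd.
  - have /existsNP[y /existsNP[y' /not_implyP[h nh]]] := nl l.
    exists (y, y'); first by rewrite /Z /= leNgt; apply/negP.
    by move=> j /h /= ->; rewrite subrr subr0 normr0.
  - have yE : y = y'.
      apply: sepg => i n; apply/eqP; rewrite -subr_eq0; apply/eqP.
      exact: (yy' (i, n)).
    by move: Zy; rewrite /Z /= yE subrr normr0 leNgt invr_gt0 ltr0n.
have /choice[l hl] := net.
exists (\bigcup_k [set` map fst (l k)]).
  by apply: bigcup_countable => // k _; apply: finite_set_countable; exact: finite_seq.
move=> y y' yy'; apply/eqP; rewrite -subr_eq0 -normr_le0.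
apply/ler_addgt0Pl => d d0; rewrite addr0.
have [k] := ltr_add_invr d0; rewrite add0r => kd.
apply: ltW; apply: lt_trans kd; apply: hl => -[i n] jl /=; apply: yy'.
by exists k => //=; apply/mapP; exists (i, n).
Qed.

(** * Polynomials in the functions [e h] and the closing-off operator *)

Let over (X : eqType) (A : set X) (l : seq X) := [set` l] `<=` A.

Definition evprod (l : seq Y) (x : K) : R := \prod_(h <- l) e h x.

Lemma evprod_continuous l : over H l -> continuous (evprod l).
Proof.
elim: l => [_|h l IH hl].
  by rewrite /evprod; under eq_fun do rewrite big_nil; exact: cst_continuous.
rewrite /evprod; under eq_fun do rewrite big_cons.
move=> x; apply: cvgM.
  by apply: ce; apply: hl; rewrite /= mem_head.
by apply: IH => h' h'l; apply: hl; rewrite /= inE h'l orbT.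
Qed.

(** The real shifts allow zeros to be prescribed, but make these products uncountably many even over
    a countable set of [h]. The closing-off therefore deals with the monomials [evprod], from which
    linearity recovers these products. *)
Definition shiftprod (l : seq (Y * R)) (x : K) : R := \prod_(p <- l) (e p.1 x - p.2).

Lemma shiftprod_continuous l : over H (map fst l) -> continuous (shiftprod l).
Proof.
elim: l => [_|[h t] l IH hl].
  by rewrite /shiftprod; under eq_fun do rewrite big_nil; exact: cst_continuous.
rewrite /shiftprod; under eq_fun do rewrite big_cons /=.
move=> x; apply: cvgM.
  apply: cvgB; last exact: cvg_cst.
  by apply: ce; apply: hl; rewrite /= mem_head.
by apply: IH => h' h'l; apply: hl; rewrite /= inE h'l orbT.
Qed.

(** Multiply one factor [e h - e h p] for each [p], with [h] separating [p] from [x]. *)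
Lemma annihilator (B : set Y) (P : seq K) x :
  (forall p, p \in P -> exists2 h, B h & e h p <> e h x) ->
  exists l : seq (Y * R), [/\ over B (map fst l),
    forall p, p \in P -> shiftprod l p = 0 & shiftprod l x <> 0].
Proof.
elim: P => [_|p P IH hP].
  by exists [::]; split=> //; rewrite /shiftprod big_nil; apply/eqP; exact: oner_neq0.
have [|l [lB lP lx]] := IH.
  by move=> q qP; apply: hP; rewrite inE qP orbT.
have [|h Bh hpx] := hP p; first by rewrite mem_head.
exists ((h, e h p) :: l); split.
- by move=> h' /=; rewrite inE => /orP[/eqP->//|/lB].
- move=> q; rewrite inE /shiftprod big_cons /= => /orP[/eqP->|/lP lq].
    by rewrite subrr mul0r.
  by rewrite -/(shiftprod l q) lq mulr0.
- rewrite /shiftprod big_cons /= => /eqP; rewrite mulf_eq0 => /orP[|/eqP//].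
  by rewrite subr_eq0 => /eqP /esym.
Qed.

Let approxL (k : seq (I * nat)) :=
  cid (@approx_countable R _ L setT (fun j => g j.1 j.2) k).
Let approxH (l : seq K) := cid (@approx_countable R _ Y H (fun x h => e h x) l).

(* [Dop S] is dense in [LS S], its image [Aop (Dop S)] is dense in [XS S], and
   [Bop (Aop (Dop S))] is the set [B_S] of the header. [Cop] and
   [Sop] collect the indices needed to close off [S]. *)
Let Dop (S : set I) : set L := \bigcup_(l in over S)
  \bigcup_N projT1 (approxL [seq (i, n) | i <- l, n <- iota 0 N]).
Let Aop (D : set L) : set K := \bigcup_(l in over D) [set` flatten (map supp l)].
Let Bop (A : set K) : set Y := \bigcup_(l in over A) projT1 (approxH l).

(** The condition on [l] sits under the existential so that [Cop] can select a countable set for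
    every sequence. *)
Let evprod_dep (l : seq Y) : exists c : set I, countable c /\
  (over H l -> forall y y', (forall i n, c i -> g i n y = g i n y') ->
    T (evprod l) y = T (evprod l) y').
Proof.
have [hl|nl] := pselect (over H l); last by exists set0; split.
have [c cc hc] := countable_dependence (T_continuous (evprod_continuous hl)).
by exists c; split.
Qed.

Let Cop (B : set Y) : set I := \bigcup_(l in over B) projT1 (cid (evprod_dep l)).
Let Sop (D : set L) : set I := \bigcup_(l in over D)
  [set i | exists y, y \in l /\ exists n, g i n y <> 0].

(** When [Phi S] is contained in [S], the points of [Dop S] have all their nonzero coordinates in
    [S], and [T] sends each monomial over [B_S] to a function of the coordinates in [S]. *)
Let Phi (S : set I) := Sop (Dop S) `|` Cop (Bop (Aop (Dop S))).

Let Dop_finitary : finitary Dop.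
Proof.
apply: finitary_bigcup => l; apply: bigcup_countable => // N _.
by have [] := projT2 (approxL [seq (i, n) | i <- l, n <- iota 0 N]).
Qed.

Let Bop_finitary : finitary Bop.
Proof. by apply: finitary_bigcup => l; have [] := projT2 (approxH l). Qed.

Let Aop_finitary : finitary Aop.
Proof.
by apply: finitary_bigcup => l; apply: finite_set_countable; exact: finite_seq.
Qed.

Let Cop_finitary : finitary Cop.
Proof. by apply: finitary_bigcup => l; have [] := projT2 (cid (evprod_dep l)). Qed.

Let Sop_finitary : finitary Sop.
Proof.
apply: finitary_bigcup => l; apply: finite_set_countable.
have [_ fing _] := NYg.
elim: l => [|y l IH].
  by apply: (@sub_finite_set _ _ set0) => [i [y []]//|]; exact: finite_set0.
apply: (@sub_finite_set _ _ ([set i | exists n, g i n y <> 0] `|`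
    [set i | exists y, y \in l /\ exists n, g i n y <> 0])); last first.
  by rewrite finite_setU; split=> //; exact: fing.
move=> i [z []]; rewrite inE => /orP[/eqP->|zl] zi; [by left|by right; exists z].
Qed.

Let Phi_finitary : finitary Phi.
Proof.
apply: finitaryU; first exact: finitary_comp Dop_finitary Sop_finitary.
apply: (finitary_comp (F := Bop \o (Aop \o Dop))) Cop_finitary.
apply: finitary_comp Bop_finitary.
exact: finitary_comp Dop_finitary Aop_finitary.
Qed.

Let LS (S : set I) : set L := [set y | forall i n, ~ S i -> g i n y = 0].
Let XS (S : set I) : set K := [set x | exists2 y, LS S y & x \in supp y].

Let B_H A : Bop A `<=` H.
Proof.
by move=> h [l _ lh]; have [_ sub _] := projT2 (approxH l); exact: sub.
Qed.

(** * The closed sets [XS S] *)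

Section closed_index_set.
Context (S : set I) (PhiS : Phi S `<=` S).

Let D_LS d : Dop S d -> LS S d.
Proof.
move=> Dd i n nSi; apply: contrapT => gi; apply: nSi; apply: PhiS; left.
exists [:: d]; first by move=> z; rewrite /= inE => /eqP->.
by exists d; split; [rewrite mem_head|exists n].
Qed.

Let D_dense y (k : seq (I * nat)) (d : R) : 0 < d ->
  (forall j, j \in k -> S j.1) ->
  exists2 z, Dop S z & forall j, j \in k -> `|g j.1 j.2 z - g j.1 j.2 y| < d.
Proof.
(* [Dop] approximates only on grids, so [k] is enlarged to the grid [l] times [iota 0 N]. *)
move=> d0 kS; pose l := map fst k; pose N := (\max_(j <- k) j.2).+1.
have [_ _ /(_ y d Logic.I d0)[z Ez hz]] :=
  projT2 (approxL [seq (i, n) | i <- l, n <- iota 0 N]).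
exists z.
  exists l; last by exists N.
  by move=> i /= /mapP[j jk ->]; exact: kS.
move=> j jk; apply: hz; apply/allpairsP; exists j; split.
- by apply/mapP; exists j.
- by rewrite mem_iota /= add0n ltnS; exact: leq_bigmax_seq.
- by case: j {jk}.
Qed.

(** Restriction of [y] to [S]: points of [Dop S] vanish off [S] and approximate [y] on [S], and
    compactness of [L] provides an exact solution. *)
Let rho_ex y : exists2 y', LS S y' & forall i n, S i -> g i n y' = g i n y.
Proof.
have [cg _ _] := NYg.
have [|k d d0|z _ hz] := @compact_approx R L setT (I * nat)%type
   (fun j => g j.1 j.2) (fun j => if `[< S j.1 >] then g j.1 j.2 y else 0) cL.
- by move=> j; exact: cg.
- have [|z Dz hz] := @D_dense y [seq j <- k | `[< S j.1 >]] d d0.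
    by move=> j; rewrite mem_filter => /andP[/asboolP].
  exists z => // j jk; case: asboolP => Sj.
    by apply: hz; rewrite mem_filter jk andbT; apply/asboolP.
  by rewrite (D_LS Dz _ Sj) subrr normr0.
- exists z => [i n nSi|i n Si]; have := hz (i, n) => /=; case: asboolP => //.
Qed.

Let evprod_inv l y y' : over (Bop (Aop (Dop S))) l ->
  (forall i n, S i -> g i n y' = g i n y) -> T (evprod l) y = T (evprod l) y'.
Proof.
move=> lB yy'; have [_ hc] := projT2 (cid (evprod_dep l)).
apply: hc => [h /lB/B_H//|i n ci]; rewrite yy'//.
by apply: PhiS; right; exists l.
Qed.

Let shiftprod_inv l' y y' : over (Bop (Aop (Dop S))) (map fst l') ->
  (forall i n, S i -> g i n y' = g i n y) -> T (shiftprod l') y = T (shiftprod l') y'.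
Proof.
move=> lB yy'.
(* An extra monomial factor is carried along to absorb [e h] when a factor [e h - t] is expanded. *)
suff h l : over (Bop (Aop (Dop S))) l ->
    T (fun x => shiftprod l' x * evprod l x) y = T (fun x => shiftprod l' x * evprod l x) y'.
  have -> : shiftprod l' = (fun x => shiftprod l' x * evprod [::] x).
    by apply/funext => x; rewrite /evprod big_nil mulr1.
  exact: h.
elim: l' lB l => [_|[h t] l' IH lB] l lB'.
  have -> : (fun x => shiftprod [::] x * evprod l x) = evprod l.
    by apply/funext => x; rewrite /shiftprod big_nil mul1r.
  exact: evprod_inv.
have l'B : over (Bop (Aop (Dop S))) (map fst l').
  by move=> h' h'l; apply: lB; rewrite /= inE h'l orbT.
have hlB : over (Bop (Aop (Dop S))) (h :: l).
  by move=> h'; rewrite /= inE => /orP[/eqP->|/lB'//]; apply: lB; rewrite /= mem_head.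
have -> : (fun x => shiftprod ((h, t) :: l') x * evprod l x) =
   (fun x => - t * (shiftprod l' x * evprod l x) + shiftprod l' x * evprod (h :: l) x).
  by apply/funext => x; rewrite /shiftprod /evprod !big_cons /=; ring.
have cgf l0 : over (Bop (Aop (Dop S))) l0 ->
    continuous (fun x => shiftprod l' x * evprod l0 x).
  move=> l0B x; apply: cvgM.
    by apply: shiftprod_continuous => h' /l'B/B_H.
  by apply: evprod_continuous => h' /l0B/B_H.
by rewrite !T_linear ?IH//; exact: cgf.
Qed.

(** Let [Q] detect values at [x]. If no point of [XS S] has the coordinates of [x], some product
    vanishes on the supports of all [rho y] with [y] in [Q], but not at [x]. Its image under [T]
    vanishes at each [rho y], hence by invariance at each [y] in [Q], so the product vanishes at
    [x]: a contradiction. *)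
Let onto x : exists2 x', XS S x' & forall h, Bop (Aop (Dop S)) h -> e h x' = e h x.
Proof.
have [Q hQ] := T_inj x.
have /choice[rho hrho] : forall y, exists y', LS S y' /\
    forall i n, S i -> g i n y' = g i n y.
  by move=> y; have [y' ? ?] := rho_ex y; exists y'.
apply: contrapT => nx.
have [p|l [lB lP lx]] := @annihilator (Bop (Aop (Dop S)))
    (flatten (map (supp \o rho) Q)) x.
  move=> /flattenP[s /mapP[y yQ ->] py]; apply: contrapT => nh; apply: nx.
  exists p; first by exists (rho y) => //; have [] := hrho y.
  by move=> h Bh; apply: contrapT => hpx; apply: nh; exists h.
have cl : continuous (shiftprod l) by apply: shiftprod_continuous => h /lB/B_H.
apply: lx; apply: hQ => // y yQ.
rewrite (shiftprod_inv lB (hrho y).2); apply: supp_det => // p py.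
by apply: lP; apply/flattenP; exists (supp (rho y)) => //; apply/mapP; exists y.
Qed.

(** If [T u y] is nonzero with [u] supported near [x], then by density of [Dop S] in [LS S] so is
    [T u d] for some [d] in [Dop S], and the support of [d] comes near [x]. *)
Let XS_closure : XS S `<=` closure (Aop (Dop S)).
Proof.
move=> x [y LSy xy] U; rewrite nbhsE => -[V [oV Vx] VU].
have [u [cu u0 Tu]] := supp_lsc xy oV Vx.
have [cg _ sepg] := NYg.
have [d Dd Td] : exists2 d, Dop S d & T u d <> 0.
  apply: contrapT => nd; apply: Tu.
  have cZ : compact [set z | T u z = 0].
    rewrite -[X in compact X]setTI; apply: compact_closedI => //.
    apply: (@preimage_closed _ _ (T u) [set x | x = 0]); last exact: closed_eq.
    by move=> z _; exact: T_continuous.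
  have [|k d d0|z Tz hz] := @compact_approx R L _ (I * nat)%type
     (fun j => g j.1 j.2) (fun j => g j.1 j.2 y) cZ.
  - by move=> j; exact: cg.
  - have [|z Dz hz] := @D_dense y [seq j <- k | `[< S j.1 >]] d d0.
      by move=> j; rewrite mem_filter => /andP[/asboolP].
    exists z.
      by apply: contrapT => Tz; apply: nd; exists z.
    move=> j jk; have [Sj|nSj] := pselect (S j.1).
      by apply: hz; rewrite mem_filter jk andbT; apply/asboolP.
    by rewrite (D_LS Dz _ nSj) (LSy _ _ nSj) subrr normr0.
  - suff -> : y = z by [].
    by apply: sepg => i n; rewrite (hz (i, n)).
have [p pd Vp] : exists2 p, p \in supp d & V p.
  apply: contrapT => np; apply: Td; apply: supp_det => // p pd.
  by apply: u0 => Vp; apply: np; exists p.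
exists p; split; last exact: VU.
exists [:: d]; first by move=> z; rewrite /= inE => /eqP->.
by apply/flattenP; exists (supp d) => //; rewrite /= mem_head.
Qed.

(** For [h] in [H], elements of [Bop (Aop (Dop S))] approximate [h] on finite parts of [Aop (Dop S)]
    and do not separate [x] from [x']. A limit [h'] in the compact [H] agrees with [h] on the whole
    closure and still does not separate them. *)
Let closure_sep x x' : closure (Aop (Dop S)) x -> closure (Aop (Dop S)) x' ->
  (forall h, Bop (Aop (Dop S)) h -> e h x = e h x') -> x = x'.
Proof.
move=> Ax Ax' xx'; apply: sepH => h Hh.
pose A := Aop (Dop S).
(* Index [Some a] imposes agreement with [h] at [a] in [A]; index [None] imposes equal values at [x]
   and [x']. *)
have [|k d d0|h' Hh' hh'] := @compact_approx R Y H (option K)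
  (fun o h' => if o is Some a then if `[< A a >] then e h' a else 0
               else e h' x - e h' x')
  (fun o => if o is Some a then if `[< A a >] then e h a else 0 else 0) cH.
- move=> [a|]; last by move=> h'; apply: cvgB; exact: ceK.
  by case: asboolP => _; [exact: ceK|exact: cst_continuous].
- pose l := [seq a <- pmap id k | `[< A a >]].
  have [_ sub /(_ h d Hh d0)[b Eb hb]] := projT2 (approxH l).
  have Bb : Bop A b.
    exists l => // a; rewrite /= mem_filter => /andP[/asboolP//].
  exists b; first exact: B_H Bb.
  move=> [a|] ok; last by rewrite xx'// subrr subr0 normr0.
  case: asboolP => Aa; last by rewrite subr0 normr0.
  apply: hb; rewrite mem_filter mem_pmap map_id; apply/andP; split=> //.
  exact/asboolP.
- have hh'A : closure A `<=` [set z | e h' z = e h z].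
    have -> : [set z | e h' z = e h z] = [set z | e h' z - 1 * e h z - 0 = 0].
      apply/seteqP; split=> z /=; first by move=> ->; rewrite mul1r subr0 subrr.
      by rewrite subr0 mul1r => /subr0_eq.
    have cZ : closed [set z | e h' z - 1 * e h z - 0 = 0].
      by apply: closed_eq0_lin; [exact: ce|exact: ce|exact: cst_continuous].
    apply: subset_trans cZ; apply: closureS => a Aa /=.
    have := hh' (Some a) => /=; case: asboolP => // _ ->.
    by rewrite mul1r subr0 subrr.
  rewrite -(hh'A _ Ax) -(hh'A _ Ax').
  by apply/eqP; rewrite -subr_eq0; apply/eqP; exact: (hh' None).
Qed.

(** By [onto] a point of the closure shares its coordinates with a point of [XS S], and these
    coordinates separate the closure. *)
Lemma XS_closed : closed (XS S).
Proof.
suff -> : XS S = closure (Aop (Dop S)) by exact: closed_closure.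
apply/seteqP; split; first exact: XS_closure.
move=> x Ax; have [x' Xx' xx'] := onto x.
suff -> : x = x' by [].
by apply: closure_sep => // [|h Bh]; [exact: XS_closure|rewrite xx'].
Qed.

Lemma XS_sep x x' : XS S x -> XS S x' ->
  (forall h, Bop (Aop (Dop S)) h -> e h x = e h x') -> x = x'.
Proof. by move=> /XS_closure Ax /XS_closure Ax'; exact: closure_sep. Qed.

Lemma XS_onto x : exists x', XS S x' /\
  forall h, Bop (Aop (Dop S)) h -> e h x' = e h x.
Proof. by have [x' ? ?] := onto x; exists x'. Qed.

End closed_index_set.

Let BA_finitary : finitary (Bop \o (Aop \o Dop)).
Proof.
apply: finitary_comp Bop_finitary.
exact: finitary_comp Dop_finitary Aop_finitary.
Qed.

(** Otherwise [annihilator] gives a function vanishing on the supports of the points of [Q] but not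
    at [x], although [Q] detects values at [x]. *)
Let mem_supp x : exists y, x \in supp y.
Proof.
have [Q hQ] := T_inj x; apply: contrapT => /forallNP nx.
have [p|l [lH lP lx]] := @annihilator H (flatten (map supp Q)) x.
  move=> /flattenP[s /mapP[y yQ ->] py]; apply: contrapT => nh; apply: (nx y).
  suff -> : x = p by [].
  apply: sepH => h Hh; apply: contrapT => hxp; apply: nh; exists h => //.
  by move=> hpx; apply: hxp.
have cl := shiftprod_continuous lH.
apply: lx; apply: hQ => // y yQ; apply: supp_det => // p py.
by apply: lP; apply/flattenP; exists (supp y) => //; apply/mapP; exists y.
Qed.

(** [r A x] is the unique point of [X A] with the [BA A]-coordinates of [x]; uniqueness gives its
    identities and, with compactness of [X A], its continuity. *)
Theorem operator_skeleton : exists (X : set I -> set K) (r : set I -> K -> K),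
  skeleton X r /\ forall A, countable A -> exists b : nat -> K -> R,
    (forall n, continuous (b n)) /\ forall x x', X A x -> X A x' ->
      (forall n, b n x = b n x') -> x = x'.
Proof.
pose cl := hull Phi.
have PhiC A : Phi (cl A) `<=` cl A by exact: hull_closed.
pose BA A := Bop (Aop (Dop (cl A))).
have [cl_mono cl_fin cl_count] := finitary_hull Phi_finitary.
have [BA_mono _ BA_count] := BA_finitary.
pose X A := XS (cl A).
have BAH A : BA A `<=` H := @B_H _.
have Xsep A x x' : X A x -> X A x' ->
  (forall h, BA A h -> e h x = e h x') -> x = x' by exact: XS_sep.
pose r A x := projT1 (cid (XS_onto (PhiC A) x)).
have rX A x : X A (r A x) by have [] := projT2 (cid (XS_onto (PhiC A) x)).
have re A x h : BA A h -> e h (r A x) = e h x.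
  by have [_] := projT2 (cid (XS_onto (PhiC A) x)); exact.
have LS_mono A B : A `<=` B -> LS A `<=` LS B.
  by move=> AB y yA i n nBi; apply: yA => /AB.
have Xmono A B : A `<=` B -> X A `<=` X B.
  by move=> /cl_mono/LS_mono AB x [y /AB yB xy]; exists y.
exists X, r; split; first split=> //.
- move=> A; apply: (@lift_continuous R K K (X A) Y
    (fun h x => if `[< BA A h >] then e h x else 0)
    (fun h x => if `[< BA A h >] then e h x else 0)).
  + rewrite -[X A]setTI; apply: compact_closedI => //; exact: XS_closed.
  + move=> h; case: asboolP => [/BAH/ce//|_]; exact: cst_continuous.
  + move=> h; case: asboolP => [/BAH/ce//|_]; exact: cst_continuous.
  + exact: rX.
  + by move=> h x; case: asboolP => // /re ->.
  + move=> x x' Xx Xx' xx'; apply: (@Xsep A) => // h Bh.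
    by have := xx' h; case: asboolP.
- by move=> A x Xx; apply: (@Xsep A) => // h /re.
- move=> A B x AB; apply: (@Xsep A) => // h Bh; rewrite !re//.
  by apply: BA_mono Bh; exact: cl_mono.
(* The finitely many nonzero coordinates of [y] lie in the hull of a finite part of [A]. *)
- move=> A x [y LSy xy]; have [_ fing _] := NYg.
  have /finite_seqP[l lE] := fing y.
  have [i il|k kA lk] := @finitary_seq _ _ _ A l cl_mono.
    apply: cl_fin; apply: contrapT => nAi.
    have [n gi] : [set i | exists n, g i n y <> 0] i by rewrite lE.
    by apply: gi; exact: LSy.
  exists k => //; exists y => // i n nki; apply: contrapT => gi; apply: nki.
  by apply: lk; rewrite -lE; exists n.
- apply/seteqP; split=> // x _; have [y xy] := mem_supp x.
  by exists y => // i n; case; exact: sub_hull.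
- move=> A /cl_count/BA_count/countable_injP[f finj].
  exists (fun n x => if pselect (exists2 h, BA A h & f h = n) is left h
    then e (projT1 (cid2 h)) x else 0); split=> [n|x x' Xx Xx' xx'].
    case: pselect => [h|_]; last exact: cst_continuous.
    by case: (cid2 h) => h' /= /BAH/ce.
  apply: (@Xsep A) => // h Bh; have := xx' (f h); case: pselect => [h0|[]].
    case: (cid2 h0) => h' /= Bh' fh.
    by have -> : h' = h by apply: finj => //; rewrite inE.
  by exists h.
Qed.

End operator.

(** * From retractions to NY families *)

Section well_ordered.
Context (T : eqType) (le : rel T) (wo : well_order le).

(** [well_order] provides a unique least element of each nonempty set; sets of one, two and three
    points yield the order axioms. *)
Lemma wo_refl : reflexive le.
Proof.
move=> x; have [|z [[/eqP zx lez] _]] := wo (A := pred1 x).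
  by exists x; exact: eqxx.
by rewrite -{1}zx; apply: lez; exact: eqxx.
Qed.

Lemma wo_total : total le.
Proof.
move=> x y; have [|z [[/pred2P[] -> lez] _]] := wo (A := pred2 x y).
- by exists x; apply/pred2P; left.
- by apply/orP; left; apply: lez; apply/pred2P; right.
- by apply/orP; right; apply: lez; apply/pred2P; left.
Qed.

Lemma wo_anti : antisymmetric le.
Proof.
move=> x y /andP[xy yx]; have [|z [_ uz]] := wo (A := pred2 x y).
  by exists x; apply/pred2P; left.
have zx : z = x.
  apply: uz; split; first by apply/pred2P; left.
  by move=> t /pred2P[] ->//; exact: wo_refl.
have zy : z = y.
  apply: uz; split; first by apply/pred2P; right.
  by move=> t /pred2P[] ->//; exact: wo_refl.
by rewrite -zx.
Qed.

Lemma wo_trans : transitive le.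
Proof.
move=> y x z xy yz; have [|t [[+ let_] _]] := wo (A := pred3 x y z).
  by exists x; apply/or3P; apply: Or31.
move=> /or3P[] /eqP te; rewrite te in let_.
- by apply: let_; rewrite inE eqxx !orbT.
- have yx : le y x by apply: let_; rewrite inE eqxx.
  by rewrite (wo_anti (introT andP (conj xy yx))).
- have zy : le z y by apply: let_; rewrite inE eqxx orbT.
  by rewrite -(wo_anti (introT andP (conj yz zy))).
Qed.

Lemma wo_ind (P : T -> Prop) :
  (forall w, (forall v, ~~ le w v -> P v) -> P w) -> forall w, P w.
Proof.
move=> IH w; apply: contrapT => nPw.
have [|z [[/asboolP nPz lez] _]] := wo (A := fun w => `[< ~ P w >]).
  by exists w; apply/asboolP.
apply: nPz; apply: IH => v zv; apply: contrapT => nPv.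
by move/negP: zv; apply; apply: lez; apply/asboolP.
Qed.

Lemma wo_seq_max (S : eqType) (e : S -> T) (l : seq S) : l != [::] ->
  exists2 m, m \in l & forall x, x \in l -> le (e x) (e m).
Proof.
elim: l => // x [_ _|y l IH _].
  by exists x; rewrite ?mem_head// => z; rewrite inE => /eqP->; exact: wo_refl.
have [//|m ml hm] := IH; have [mx|xm] := orP (wo_total (e m) (e x)).
  exists x; rewrite ?mem_head// => z; rewrite inE => /orP[/eqP->|/hm zm].
    exact: wo_refl.
  exact: wo_trans zm mx.
exists m; first by rewrite inE ml orbT.
by move=> z; rewrite inE => /orP[/eqP->//|/hm].
Qed.

End well_ordered.

(* Hilbert's hotel. *)
Lemma infinite_shift (T : Type) (A : set T) (a : T) : infinite_set A -> ~ A a ->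
  exists2 f : T -> T, {in a |` A &, injective f} & forall x, (a |` A) x -> A (f x).
Proof.
move=> /infiniteP/card_leP[s] nAa.
pose t (n : nat) : T := set_val (s (SigSub (mem_set (Logic.I : [set: nat] n)))).
have tA n : A (t n) by exact: set_valP.
have t_inj m n : t m = t n -> m = n.
  by move=> /val_inj/(@inj _ _ _ s) => /(_ (mem_set Logic.I) (mem_set Logic.I)) [].
pose f x := if pselect (x = a) is left _ then t 0%N else
  if pselect (exists n, t n = x) is left h then t (projT1 (cid h)).+1 else x.
have fa : f a = t 0%N by rewrite /f; case: pselect.
have ft n : f (t n) = t n.+1.
  rewrite /f; case: pselect => [ta|_].
    by exfalso; apply: nAa; rewrite -ta; exact: tA.
  case: pselect => [h|[]]; last by exists n.
  by congr (t _.+1); apply: t_inj; exact: projT2 (cid h).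
have fn x : x <> a -> (forall n, t n <> x) -> f x = x.
  move=> xa xt; rewrite /f; case: pselect => // _; case: pselect => // -[n tn].
  by case: (xt n).
have cases x : [\/ x = a, exists n, x = t n | x <> a /\ forall n, t n <> x].
  have [->|xa] := pselect (x = a); first by apply: Or31.
  have [[n ->]|nt] := pselect (exists n, x = t n); first by apply: Or32; exists n.
  by apply: Or33; split=> // n tn; apply: nt; exists n.
exists f => [x y _ _|x].
  have [->|[n ->]|[xa xt]] := cases x; have [->|[m ->]|[ya yt]] := cases y => //;
    rewrite ?fa ?ft ?(fn _ xa xt) ?(fn _ ya yt) => //.
  - by move=> /t_inj.
  - by move=> /yt.
  - by move=> /t_inj.
  - by move=> /t_inj[->].
  - by move=> /yt.
  - by move=> /esym/xt.
  - by move=> /esym/xt.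
have [->|[n ->]|[xa xt]] := cases x; rewrite ?fa ?ft; [by []|by []|].
by rewrite fn// => -[].
Qed.

(** * Assembling the families along a well-ordered chain *)

Section skeleton_family.
Context (R : realType) (K : topologicalType) (I : eqType).
Context (X : set I -> set K) (r : set I -> K -> K) (sk : skeleton X r).
Context (count_sep : forall A, countable A -> exists b : nat -> K -> R,
    (forall n, continuous (b n)) /\ forall x x', X A x -> X A x' ->
      (forall n, b n x = b n x') -> x = x').

(** Continuity and finiteness are required on all of [K], so that the functions can be composed with
    retractions; only separation is confined to [X A]. *)
Let good (A : set I) := exists (J : Type) (f : J -> nat -> K -> R),
  [/\ forall j n, continuous (f j n),
      forall x, finite_set [set j | exists n, f j n x <> 0] &
      forall x x', X A x -> X A x' -> (forall j n, f j n x = f j n x') -> x = x'].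

Let good_countable A : countable A -> good A.
Proof.
move=> /count_sep[b [cb sepb]]; exists unit, (fun=> b); split=> //.
by move=> x x' Xx Xx' xx'; apply: sepb => // n; exact: (xx' tt).
Qed.

Let r_id A B x : A `<=` B -> X A (r B x) -> r A x = r B x.
Proof. by move=> AB XA; rewrite -(skel_comp sk x AB); exact: skel_id sk _ _ XA. Qed.

Context (le : rel I) (wo : well_order le).

Section step.
Context (A : set I) (e : I -> I) (e_inj : {in A &, injective e}).

(** [e] ranks the elements of [A]; [dn a] and [dl a] are the segments up to [a] with and without
    [a], the stages [S+1] and [S] of a jump. *)
Let dn a : set I := [set a' | A a' /\ le (e a') (e a)].
Let dl a : set I := [set a' | A a' /\ ~~ le (e a) (e a')].
Let initial (D : set I) := D `<=` A /\ forall a, D a -> dn a `<=` D.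

Let dl_initial a : initial (dl a).
Proof.
split=> [b []//|b [Ab nab] c [Ac cb]]; split=> //.
by apply: contra nab => ac; exact: wo_trans cb.
Qed.

Let A_initial : initial A. Proof. by split=> // a _ b []. Qed.

Let dl_dn a : dl a `<=` dn a.
Proof.
move=> b [Ab nab]; split=> //.
by have := wo_total wo (e a) (e b); rewrite (negbTE nab).
Qed.

(** Both points are generated by one finite part of [D]; its element of largest rank is [m], and the
    empty part gives the first case. *)
Let local2 D x x' : initial D -> X D x -> X D x' ->
  (X set0 x /\ X set0 x') \/ exists2 m, D m & X (dn m) x /\ X (dn m) x'.
Proof.
move=> [DA Dd] /(skel_finitary sk)[l lD lx] /(skel_finitary sk)[l' l'D l'x].
have {}lx : X [set` l ++ l'] x.
  by apply: skel_mono sk _ _ _ _ lx => y /= yl; rewrite mem_cat yl.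
have {}l'x : X [set` l ++ l'] x'.
  by apply: skel_mono sk _ _ _ _ l'x => y /= yl; rewrite mem_cat yl orbT.
have kD : [set` l ++ l'] `<=` D.
  by move=> y /=; rewrite mem_cat => /orP[/lD|/l'D].
have [k0|k0] := eqVneq (l ++ l') [::].
  by left; rewrite k0 set_nil in lx l'x.
right; have [m ml hm] := wo_seq_max wo e k0.
have kdn : [set` l ++ l'] `<=` dn m.
  by move=> y yk; split; [exact/DA/kD|exact: hm].
exists m; first exact: kD.
by split; [exact: skel_mono sk _ _ kdn _ lx|exact: skel_mono sk _ _ kdn _ l'x].
Qed.

Let jumps x D := [set a | D a /\ r (dn a) x <> r (dl a) x].

(* [r D x] lies in [X (dn m)] for some [m] in [D], so [x] has no jump after [m]. *)
Let jumps_step x D : initial D ->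
  (forall a, D a -> finite_set (jumps x (dl a))) -> finite_set (jumps x D).
Proof.
move=> iD fD; have XD := skel_in sk D x; have [DA Dd] := iD.
have dlD a : D a -> dl a `<=` D by move=> /Dd; apply: subset_trans; exact: dl_dn.
have [[X0 _]|[m Dm [Xm _]]] := local2 iD XD XD.
  apply: (@sub_finite_set _ _ set0) => // a [Da]; apply.
  rewrite (r_id (Dd _ Da)); last exact: skel_mono sk _ _ (@sub0set _ _) _ X0.
  by rewrite (r_id (dlD _ Da))//; exact: skel_mono sk _ _ (@sub0set _ _) _ X0.
apply: (@sub_finite_set _ _ ([set m] `|` jumps x (dl m))); last first.
  by rewrite finite_setU; split=> //; exact: fD.
move=> a [Da ja]; have [ma|nma] := boolP (le (e m) (e a)); last first.
  by right; split=> //; split=> //; exact: DA.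
have [am|nam] := boolP (le (e a) (e m)).
  left; apply: e_inj; rewrite ?inE; [exact: DA|exact: DA|].
  by apply: (wo_anti wo); rewrite am.
exfalso; apply: ja.
have mdl : dn m `<=` dl a.
  move=> b [Ab bm]; split=> //; apply: contra nam => ab; exact: wo_trans wo _ _ _ ab bm.
rewrite (r_id (Dd _ Da)); last first.
  by apply: skel_mono sk _ _ _ _ Xm; apply: subset_trans mdl (@dl_dn a).
by rewrite (r_id (dlD _ Da))//; exact: skel_mono sk _ _ mdl _ Xm.
Qed.

Let jumps_finite x : finite_set (jumps x A).
Proof.
suff h w : forall a, e a = w -> finite_set (jumps x (dl a)).
  by apply: jumps_step => // a _; exact: h.
elim/(wo_ind wo): w => w IH a ea; apply: jumps_step => // b [Ab nab].
by apply: (IH (e b)) => //; rewrite -ea.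
Qed.

Let agree_step x x' D : initial D -> r set0 x = r set0 x' ->
  (forall a, D a -> r (dn a) x = r (dn a) x') -> r D x = r D x'.
Proof.
move=> iD r0 rD; have [DA Dd] := iD.
have [[X0 X0']|[m Dm [Xm Xm']]] := local2 iD (skel_in sk D x) (skel_in sk D x').
  by rewrite -(r_id (@sub0set _ D) X0) -(r_id (@sub0set _ D) X0').
by rewrite -(r_id (Dd _ Dm) Xm) -(r_id (Dd _ Dm) Xm') rD.
Qed.

(** A difference indexed by [a] is nonzero at [x] only if [x] jumps at [a], which leaves finitely
    many indices. Separation goes by induction on ranks: once the retractions to [X (dl a)] agree,
    the differences at [a] reduce to the family of [dn a]. *)
Lemma good_step : (forall a, A a -> good (dn a)) -> good A.
Proof.
move=> gdn.
have gA (a : A) : good (dn (set_val a)) by apply: gdn; exact: set_valP.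
pose J (a : A) := projT1 (cid (gA a)).
pose f (a : A) : J a -> nat -> K -> R := projT1 (cid (projT2 (cid (gA a)))).
have hf (a : A) := projT2 (cid (projT2 (cid (gA a)))).
have [b [cb sepb]] := count_sep (countable0 I).
(* Index [None] carries the functions separating [X set0], the bottom of the chain. *)
pose F (o : option {a : A & J a}) n x : R :=
  if o is Some (existT a j) then
    f a j n (r (dn (set_val a)) x) - f a j n (r (dl (set_val a)) x)
  else b n (r set0 x).
exists (option {a : A & J a}), F; split.
- move=> [[a j]|] n x; last first.
    by apply: continuous_comp; [exact: skel_continuous sk _ _|exact: cb].
  have [cf _ _] := hf a.
  by apply: cvgB; apply: continuous_comp; try exact: skel_continuous sk _ _; exact: cf.
- move=> x; pose N (y : K) (a : A) := [set j : J a | exists n, f a j n y <> 0].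
  have Nfin y a : finite_set (N y a) by have [_ h _] := hf a; exact: h.
  pose G (a : A) : set (option {a : A & J a}) :=
    (fun j => Some (existT J a j)) @`
      (N (r (dn (set_val a)) x) a `|` N (r (dl (set_val a)) x) a).
  apply: (@sub_finite_set _ _ ([set None] `|`
    \bigcup_(a in jumps x A)
      if pselect (A a) is left Aa then G (SigSub (mem_set Aa)) else set0)).
    move=> [[a j]|] [n /= Fn]; last by left.
    right; exists (set_val a).
      split; first exact: set_valP.
      by move=> rr; apply: Fn; rewrite rr subrr.
    case: pselect => [Aa|[]]; last exact: set_valP.
    have -> : SigSub (mem_set Aa) = a by exact: val_inj.
    exists j => //; apply: contrapT => /not_orP[n1 n2]; apply: Fn.
    have -> : f a j n (r (dn (set_val a)) x) = 0.
      by apply: contrapT => fn; apply: n1; exists n.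
    have -> : f a j n (r (dl (set_val a)) x) = 0.
      by apply: contrapT => fn; apply: n2; exists n.
    by rewrite subr0.
  rewrite finite_setU; split=> //; apply: bigcup_finite (jumps_finite x) _.
  move=> a _; case: pselect => // Aa; apply: finite_image.
  by rewrite finite_setU.
- move=> x x' Xx Xx' xx'.
  have r0 : r set0 x = r set0 x'.
    apply: sepb => [||n]; [exact: skel_in sk _ _|exact: skel_in sk _ _|].
    exact: (xx' None).
  suff h w : forall a, e a = w -> A a -> r (dn a) x = r (dn a) x'.
    rewrite -(skel_id sk Xx) -(skel_id sk Xx').
    by apply: agree_step => // a Aa; exact: h.
  elim/(wo_ind wo): w => w IH a ea Aa.
  have rl : r (dl a) x = r (dl a) x'.
    apply: agree_step => // c [Ac nac]; apply: (IH (e c)) => //.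
    by rewrite -ea.
  pose a' : A := SigSub (mem_set Aa).
  have [_ _] := hf a'; apply; [exact: skel_in sk _ _|exact: skel_in sk _ _|].
  move=> j n; have := xx' (Some (existT J a' j)) n; rewrite /F /= rl.
  by move=> /addIr.
Qed.

(* [dn a] injects into the indices below [e a], after a shift
   when it is infinite: this replaces an induction on cardinals. *)
Lemma good_dn a :
  A a -> (forall (A' : set I) (e' : I -> I), {in A' &, injective e'} ->
    (forall b, A' b -> ~~ le (e a) (e' b)) -> good A') -> good (dn a).
Proof.
move=> Aa IH; have [cdn|ncdn] := pselect (countable (dn a)).
  exact: good_countable.
have dnE : dn a = a |` dl a.
  apply/seteqP; split=> [b [Ab ba]|b [->|/dl_dn//]]; last first.
    by split=> //; exact: wo_refl.
  have [ab|nab] := boolP (le (e a) (e b)); last by right.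
  by left; apply: e_inj; rewrite ?inE//; apply: (wo_anti wo); rewrite ba.
have [||f f_inj fdl] := @infinite_shift _ (dl a) a.
- move=> fdl; apply: ncdn; apply: finite_set_countable.
  by rewrite dnE finite_setU.
- by case=> _; rewrite (wo_refl wo).
rewrite -dnE in f_inj fdl.
apply: (IH (dn a) (e \o f)) => [b c|b].
  rewrite !inE => db dc /= efbc; apply: f_inj; rewrite ?inE//.
  apply: e_inj => //; rewrite inE; [by have [] := fdl b db|by have [] := fdl c dc].
by move=> /fdl [].
Qed.

End step.

(** By induction on [w], every set injecting strictly below [w] is good: [good_step] reduces it to
    segments [dn a], and [good_dn] reduces these to sets injecting strictly below the rank of
    [a]. *)
Lemma skeleton_NY_family : exists (J : Type) (f : J -> nat -> K -> R), NY_family f.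
Proof.
have all w : forall (A : set I) (e : I -> I), {in A &, injective e} ->
    (forall a, A a -> ~~ le w (e a)) -> good A.
  elim/(wo_ind wo): w => w IH A e e_inj ew; apply: (good_step e_inj) => a Aa.
  apply: (good_dn e_inj) => // A' e' e'_inj ea.
  exact: (IH (e a)) (ew _ Aa) _ _ e'_inj ea.
(* Under the identity no [w] lies strictly above all of [setT], so one more step is made by hand
   before [all] applies. *)
have id_inj : {in [set: I] &, injective (@id I)} by [].
have [J [f [cf ff sf]]] : good setT.
  apply: (good_step id_inj) => a Ta; apply: (good_dn id_inj) => // A' e'.
  exact: (all a).
exists J, f; split=> // x x'; apply: sf; by rewrite (skel_full sk).
Qed.

End skeleton_family.

(** * Operators between function spaces *)

Lemma Eberlein_compact_compact (R : realType) (K : topologicalType) :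
  Eberlein_compact R K -> compact [set: K].
Proof.
move=> [E [A [cA [psi [cpsi [psi' [cpsi' psiK _]]]]]]] F FF _.
pose u x : weak E := set_val (psi x).
have uA : (u @ F) A by apply: (@filterE _ F) => x; exact: set_valP (psi x).
have [z [Az clz]] := cA (u @ F) _ uA.
exists (psi' (SigSub (mem_set Az))); split=> // B U FB.
move=> /(cpsi' (SigSub (mem_set Az))) psiU.
have : nbhs (SigSub (mem_set Az) : A) (psi' @^-1` U) by exact: psiU.
rewrite nbhsE => -[_ [[V oV <-] /= Vz] VU].
have [|_ [[b Bb <-] Vb]] := clz (u @` B) V _ (open_nbhs_nbhs (conj oV Vz)).
  by apply: (@filterS _ F _ B) => // b Bb; exists b.
by exists b; split=> //; rewrite -(psiK b); exact: VU.
Qed.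

(** Exact agreement on [l] replaces closeness: it is applied to all multiples of one function, where
    a bound forces vanishing. *)
Lemma nbhs_Cp (R : realType) (X : topologicalType) (f0 : Cp R X)
    (U : set (Cp R X)) : nbhs f0 U ->
  exists l : seq X, forall f : Cp R X,
    (forall x, x \in l -> f x = f0 x) -> U f.
Proof.
rewrite nbhsE => -[_ [[B oB <-] /= Bf0] BU].
pose G := filter_from [set: seq X]
  (fun l => [set f : X -> R^o | forall x, x \in l -> f x = f0 x]).
have FG : Filter G.
  apply: filter_from_filter; first by exists [::].
  move=> l l' _ _; exists (l ++ l') => // f fE.
  by split=> x xl; apply: fE; rewrite mem_cat xl ?orbT.
have Gf0 : G --> (f0 : prod_topology (fun _ : X => R^o)).
  apply/cvg_sup => x W; rewrite nbhsE => -[_ [[D oD <-] Dx] DW].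
  by exists [:: x] => // f fE; apply: DW; rewrite /= fE ?mem_head.
have [l _ lB] : G B by apply: Gf0; apply: open_nbhs_nbhs; split.
by exists l => f fE; apply: BU; apply: lB.
Qed.

Lemma bounded_multiples (R : realType) (a : R) :
  (forall t : R, `|t * a| < 1) -> a = 0.
Proof.
move=> h; apply: contrapT => /eqP a0; have := h a^-1.
by rewrite mulVf// normr1 ltxx.
Qed.

Section Cp_operator.
Context (R : realType) (K L : topologicalType).
Context (T : {linear Cp R K -> Cp R L}) (embT : embedding T).

Definition Cp_of (f : K -> R) (cf : continuous f) : Cp R K :=
  mkcts (cf : continuous (f : K -> R^o)).

(** Extended by zero to discontinuous functions, so as to act on plain functions. *)
Definition operator (f : K -> R) : L -> R :=
  if pselect (continuous f) is left cf then T (Cp_of cf) else fun=> 0.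

Lemma operatorE (f : K -> R) (cf : continuous f) : operator f = T (Cp_of cf).
Proof.
rewrite /operator; case: pselect => // cf'.
by congr (T _ : L -> R); exact/continuousEP.
Qed.

Lemma Cp_linearE (X : topologicalType) (a : R) (f f' : Cp R X) x :
  (a *: f + f') x = a * f x + f' x.
Proof. by []. Qed.

Lemma operator_continuous f : continuous f -> continuous (operator f).
Proof. by move=> cf; rewrite (operatorE cf); exact: cts_fun. Qed.

Lemma operator_linear (a : R) (f f' : K -> R) y : continuous f ->
  continuous f' ->
  operator (fun x => a * f x + f' x) y = a * operator f y + operator f' y.
Proof.
move=> cf cf'; have cff' : continuous (fun x => a * f x + f' x).
  by move=> x; apply: cvgD; [apply: cvgMr; exact: cf|exact: cf'].
rewrite (operatorE cf) (operatorE cf') (operatorE cff') -Cp_linearE -linearP.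
by congr (T _ y); exact/continuousEP.
Qed.

(** Continuity of [f |-> T f y] at 0 gives a finite [P] such that functions vanishing on [P] have
    [T f y] of modulus below 1; so do all their multiples, whence the value is 0. *)
Lemma operator_local y : exists P : seq K, forall f : K -> R,
  continuous f -> (forall x, x \in P -> f x = 0) -> operator f y = 0.
Proof.
have [cT _] := embT.
have cTy : continuous (fun f : Cp R K => (T f : L -> R^o) y).
  move=> f.
  apply: (@continuous_comp _ _ _ (corestrict T)
    (fun h : range T => (set_val h : L -> R^o) y)); first exact: cT.
  apply: (@continuous_comp _ _ _ set_val (fun h : Cp R L => (h : L -> R^o) y)).
    exact: initial_continuous.
  apply: (@continuous_comp _ _ _
    (fun h : Cp R L => (h : L -> R^o) : prod_topology (fun=> R^o))
    (fun h => h y)); first exact: initial_continuous.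
  exact: prod_coord_continuous.
have /nbhs_Cp[P hP] : nbhs (0 : Cp R K) [set f | `|(T f : L -> R^o) y| < 1].
  have /cvgr0_norm_lt : (T f : L -> R^o) y @[f --> (0 : Cp R K)] --> (0 : R).
    by have := cTy 0; rewrite /continuous_at linear0.
  by apply.
exists P => f cf fP; rewrite (operatorE cf); apply: bounded_multiples => t.
have -> : t * T (Cp_of cf) y = T (t *: Cp_of cf) y by rewrite linearZ.
apply: hP => x xP; rewrite -[t *: _]addr0 Cp_linearE.
by rewrite (_ : Cp_of cf x = 0) ?mulr0 ?add0r//; exact: fP.
Qed.

(** The same argument for the inverse of [T], which is continuous on the range. *)
Lemma operator_inj x : exists Q : seq L, forall f : K -> R,
  continuous f -> (forall y, y \in Q -> operator f y = 0) -> f x = 0.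
Proof.
have [_ [G [cG TG _]]] := embT.
have cGx : continuous (fun h : range T => (G h : K -> R^o) x).
  move=> h.
  apply: (@continuous_comp _ _ _ G (fun f : Cp R K => (f : K -> R^o) x)).
    exact: cG.
  apply: (@continuous_comp _ _ _
    (fun f : Cp R K => (f : K -> R^o) : prod_topology (fun=> R^o))
    (fun f => f x)); first exact: initial_continuous.
  exact: prod_coord_continuous.
have : nbhs (corestrict T 0) [set h | `|(G h : K -> R^o) x| < 1].
  have /cvgr0_norm_lt : (G h : K -> R^o) x @[h --> corestrict T 0] --> (0 : R).
    by have := cGx (corestrict T 0); rewrite /continuous_at TG.
  by apply.
rewrite nbhsE => -[_ [[B oB <-] B0] BU].
have /nbhs_Cp[Q hQ] := open_nbhs_nbhs (conj oB B0).
exists Q => f cf fQ; apply: bounded_multiples => t.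
suff : [set h | `|(G h : K -> R^o) x| < 1] (corestrict T (t *: Cp_of cf)).
  by rewrite /= TG.
apply: BU; apply: hQ => y yQ.
change (T (t *: Cp_of cf) y = T 0 y); rewrite linearZ_LR linear0.
by rewrite -[t *: _]addr0 Cp_linearE -operatorE fQ// mulr0 add0r.
Qed.

End Cp_operator.

Theorem theorem4p13 (R : realType) (K L : topologicalType)
    (tK : tychonoff_space K) (tL : tychonoff_space L)
    (EK : Eberlein_compact R K) (NL : NY_compact R L)
    (hT : exists T : {linear Cp R K -> Cp R L}, embedding T) :
  NY_compact R K.
Proof.
have cK := Eberlein_compact_compact EK.
have [crK hK] := tK.
have [T embT] := hT.
have [Y [H [e [cH ce ceK sepH]]]] := Eberlein_pairing EK hK.
have [I [g NYg]] := NY_compact_family NL.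
have cL : compact [set: L] by have [] := NL.
have [X [r [sk count_sep]]] := operator_skeleton cK cL crK
  (operator_linear T) (@operator_continuous _ _ _ T) (operator_local embT)
  (operator_inj embT) (I := {classic I}) NYg cH ce ceK sepH.
have [le wo] := well_ordering_principle {classic I}.
have [J [f NYf]] := skeleton_NY_family sk count_sep wo.
exact: NY_family_compact NYf.
Qed.
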